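(* Let $(u,0,\mu)\in\mathcal D$ and put $F(x)=\mu((-\infty,x])$. For $n\in\mathbb N$ let $(u_n,\rho_n,\mu_n)$ be given by $$u_n(x)=\int_{\mathbb R} n\phi(n(x-y))u(y)\,dy,$$ $$\rho_n(x)=\Big(\frac1{n^2}+\int_{\mathbb R} n\phi'(y)F\big(x-\tfrac{y}{n}\big)dy-\Big(\int_{\mathbb R}\phi(y)u_x\big(x-\tfrac{y}{n}\big)dy\Big)^2\Big)^{1/2}=\frac1n+\bar\rho_n(x),$$ $$\mu_n=\big(u_{n,x}^2(x)+\bar\rho_n^2(x)\big)\,dx$$ (the second line defines $\bar\rho_n=\rho_n-\frac1n$, and $\mu_n$ is the absolutely continuous measure with the indicated density), and define $F_n(x)=\mu_n((-\infty,x])$. Then $(u_n,\rho_n,\mu_n)\in\mathcal D$ for every $n$, the functions $u_n$, $\rho_n$ and the density of $\mu_n$ are smooth ($C^\infty(\mathbb R)$), and, as $n\to\infty$, $$u_n\to u\ \text{ in } H^1(\mathbb R),\qquad F_n(x)\to F(x)\ \text{ for every } x \text{ at which } F \text{ is continuous.}$$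
   Context: $L^2_{\rm const}(\mathbb R)$ is the set of $\rho\in L^1_{\rm loc}(\mathbb R)$ of the form $\rho=\bar\rho+k$ with $\bar\rho\in L^2(\mathbb R)$ and $k\in\mathbb R$; the pair $(\bar\rho,k)$ is uniquely determined by $\rho$. The set $\mathcal D$ (Eulerian coordinates) consists of all triples $(u,\rho,\mu)$ such that $u\in H^1(\mathbb R)$, $\rho=\bar\rho+k\in L^2_{\rm const}(\mathbb R)$, and $\mu$ is a positive finite Radon measure on $\mathbb R$ whose absolutely continuous part is $\mu_{\rm ac}=(u_x^2+\bar\rho^2)\,dx$. In particular $(u,0,\mu)\in\mathcal D$ means $\mu_{\rm ac}=u_x^2\,dx$. $\phi\in C_c^\infty(\mathbb R)$ is a fixed Friedrichs mollifier with $\phi(x)=\phi(-x)\ge0$, $\|\phi\|_{L^1}=1$, $\phi'(x)>0$ for $x\in(-1,0)$, and $\operatorname{supp}\phi=[-1,1]$. *)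

(* Defs.v *)
From HB Require Import structures.
From mathcomp Require Import all_boot all_order all_algebra.
From mathcomp Require Import all_classical all_reals all_analysis.

Set Implicit Arguments.
Unset Strict Implicit.
Unset Printing Implicit Defensive.
Import Order.TTheory GRing.Theory Num.Theory.
Import numFieldNormedType.Exports.

Local Open Scope ring_scope.
Local Open Scope classical_set_scope.

Definition smooth (R : realType) (f : R -> R) : Prop :=
  forall (k : nat) (x : R), derivable (f^`(k)) x 1.

Definition supp (R : realType) (f : R -> R) : set R :=
  closure [set x | f x != 0].

Definition test_function (R : realType) (f : R -> R) : Prop :=
  smooth f /\ compact (supp f).

Definition friedrichs_mollifier (R : realType) (phi : R -> R) : Prop :=
  [/\ test_function phi,
      forall x, phi x = phi (- x) /\ 0 <= phi x,
      ('N[lebesgue_measure]_1[EFin \o phi] = 1)%E,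
      forall x, x \in `]-1, 0[ -> 0 < phi^`() x &
      supp phi = `[-1, 1]].

(* Elements of [L2] and [H1] are represented by arbitrary Borel
   representatives; every notion below depends only on the a.e. class. *)
Definition L2 (R : realType) (f : R -> R) : Prop :=
  f \in Lfun (@lebesgue_measure R) 2%:E.

Definition weak_derivative (R : realType) (f g : R -> R) : Prop :=
  forall psi : R -> R, test_function psi ->
    \int[lebesgue_measure]_x (f x * psi^`()%classic x) =
    - \int[lebesgue_measure]_x (g x * psi x).

Definition H1 (R : realType) (u : R -> R) : Prop :=
  L2 u /\ exists2 v, L2 v & weak_derivative u v.

(* A chosen representative of u_x in L^2; meaningful only when [H1 u]. *)
Definition weakD (R : realType) (u : R -> R) : R -> R :=
  get [set v : R -> R | L2 v /\ weak_derivative u v].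

Definition H1_norm (R : realType) (u : R -> R) : \bar R :=
  ((\int[lebesgue_measure]_x (u x ^+ 2 + weakD u x ^+ 2)%:E) `^ 2^-1)%E.

Definition L2const_decomp (R : realType) (rho rhobar : R -> R) (k : R) : Prop :=
  [/\ locally_integrable setT rho, L2 rhobar & forall x, rho x = rhobar x + k].

Definition density_measure (R : realType) (g : R -> R)
    (A : set (measurableTypeR R)) : \bar R :=
  (\int[lebesgue_measure]_(x in A) (g x)%:E)%E.

(* Every finite Borel measure on R is Radon. Set functions are compared on
   measurable sets only, their values elsewhere being irrelevant. *)
Definition finite_radon_measure (R : realType)
    (mu : set (measurableTypeR R) -> \bar R) : Prop :=
  exists m : {finite_measure set (measurableTypeR R) -> \bar R},
    forall A, measurable A -> mu A = m A.

Definition mutually_singular (R : realType)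
    (mu nu : set (measurableTypeR R) -> \bar R) : Prop :=
  exists N, [/\ measurable N, mu N = 0%E & nu (~` N) = 0%E].

(* [nu] is the absolutely continuous part in the Lebesgue decomposition of
   [mu] with respect to Lebesgue measure. *)
Definition ac_part (R : realType)
    (mu nu : set (measurableTypeR R) -> \bar R) : Prop :=
  exists a s : {measure set (measurableTypeR R) -> \bar R},
    [/\ forall A, measurable A -> mu A = (a A + s A)%E,
        a `<< lebesgue_measure,
        mutually_singular lebesgue_measure s &
        forall A, measurable A -> nu A = a A].

Definition eulerian (R : realType) (u rho : R -> R)
    (mu : set (measurableTypeR R) -> \bar R) : Prop :=
  [/\ H1 u, finite_radon_measure mu &
      exists (rhobar : R -> R) (k : R),
        L2const_decomp rho rhobar k /\
        ac_part mu
          (density_measure (fun x => weakD u x ^+ 2 + rhobar x ^+ 2))].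

Definition distr (R : realType) (mu : set (measurableTypeR R) -> \bar R)
    (x : R) : R := fine (mu `]-oo, x]).

Definition approx_u (R : realType) (phi u : R -> R) (n : nat) (x : R) : R :=
  \int[lebesgue_measure]_y (n%:R * phi (n%:R * (x - y)) * u y).

Definition approx_radicand (R : realType) (phi u : R -> R)
    (mu : set (measurableTypeR R) -> \bar R) (n : nat) (x : R) : R :=
  1 / n%:R ^+ 2
  + \int[lebesgue_measure]_y
      (n%:R * phi^`()%classic y * distr mu (x - y / n%:R))
  - (\int[lebesgue_measure]_y (phi y * weakD u (x - y / n%:R))) ^+ 2.

Definition approx_rho (R : realType) (phi u : R -> R)
    (mu : set (measurableTypeR R) -> \bar R) (n : nat) (x : R) : R :=
  Num.sqrt (approx_radicand phi u mu n x).

Definition approx_rhobar (R : realType) (phi u : R -> R)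
    (mu : set (measurableTypeR R) -> \bar R) (n : nat) (x : R) : R :=
  approx_rho phi u mu n x - 1 / n%:R.

(* The function u_n is smooth, so u_{n,x} here is its classical derivative. *)
Definition approx_density (R : realType) (phi u : R -> R)
    (mu : set (measurableTypeR R) -> \bar R) (n : nat) (x : R) : R :=
  (approx_u phi u n)^`()%classic x ^+ 2 + approx_rhobar phi u mu n x ^+ 2.

Definition approx_mu (R : realType) (phi u : R -> R)
    (mu : set (measurableTypeR R) -> \bar R) (n : nat)
    : set (measurableTypeR R) -> \bar R :=
  density_measure (approx_density phi u mu n).

(* Main.v *)
Require Import Defs.
From HB Require Import structures.
From mathcomp Require Import all_boot all_order all_algebra.
From mathcomp Require Import all_classical all_reals all_analysis.
From mathcomp Require Import measurable_realfun.
From mathcomp Require Import ring lra.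

(* Write [phi_n(z) = n phi(n z)] and [M_n(x) = int phi_n(x - z) dmu(z)]. By
   Fubini the radicand equals [1/n^2 + M_n - u_{n,x}^2] with
   [u_{n,x} = phi_n * u_x]. Jensen's inequality and [u_x^2 dx <= mu] give
   [u_{n,x}^2 <= M_n], so the radicand is at least [1/n^2], its square root is
   smooth, and the density of [mu_n] is [M_n - (2/n) rhobar_n] with
   [0 <= rhobar_n^2 <= M_n]. Convergence in H^1 is the L^2-convergence of
   mollifications, obtained from the Lebesgue differentiation theorem and
   Fatou's lemma. The primitive of [M_n] lies between [F(x - 1/n)] and
   [F(x + 1/n)], and on a bounded interval the correction [(2/n) rhobar_n] has
   integral O(1/n); the mass of [mu] near -oo is small. *)

Set Implicit Arguments.
Unset Strict Implicit.
Unset Printing Implicit Defensive.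

Import Order.TTheory GRing.Theory Num.Theory.
Import numFieldNormedType.Exports.

Local Open Scope ring_scope.
Local Open Scope classical_set_scope.

(** * Smooth functions and test functions *)

(** The term 1/n has two roles: it keeps the square root away from its singularity at 0, and it is
    the constant [k] in the decomposition of [rho_n]. Its price is the cross term (2/n) rhobar_n, by
    which the density of [mu_n] falls short of [M_n]. This term is nonnegative, so the upper bound
    on [F_n] costs nothing. The lower bound is the delicate one: rhobar_n is only known to be square
    integrable, so its integral over a half-line is not controlled. Hence the half-line is cut at a
    point [a] that is chosen before [n]. A second obstacle is that [weakD] is an arbitrary choice:
    for [u_n] it has to be identified with the classical derivative, by almost everywhere uniqueness
    of weak derivatives, which itself comes from mollifying at Lebesgue points. Convolution is
    developed against an arbitrary measure, so that one theory serves [u], [u_x] and the mollified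
    [mu]. *)

Section smooth.
Context {R : realType}.
Implicit Types f g : R -> R.

(** Every iterated derivative stays in [P], so a single differentiation step has to be checked. *)
Lemma smooth_coind (P : (R -> R) -> Prop) :
  (forall f, P f -> (forall x, derivable f x 1) /\ P f^`()) ->
  forall f, P f -> smooth f.
Proof.
move=> PS f Pf k; suff : P f^`(k) by move=> /PS[].
by elim: k => [//|k Pk]; rewrite derive1nS; case: (PS _ Pk).
Qed.

Lemma smooth_derivable f x : smooth f -> derivable f x 1.
Proof. by move=> /(_ 0%N x). Qed.

Lemma smooth_derive1 f : smooth f -> smooth f^`().
Proof. by move=> sf k x; rewrite -derive1Sn. Qed.

Lemma derivable_continuous f : (forall x, derivable f x 1) -> continuous f.
Proof.
by move=> df x; apply: differentiable_continuous; apply/derivable1_diffP.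
Qed.

Lemma smooth_continuous f : smooth f -> continuous f.
Proof. by move=> sf; apply: derivable_continuous => x; exact: smooth_derivable. Qed.

Lemma smooth_measurable f (D : set R) : smooth f -> measurable_fun D f.
Proof.
move=> sf; apply: measurable_funTS; apply: continuous_measurable_fun.
exact: smooth_continuous.
Qed.

(* This class is stable under differentiation, so [smooth_coind] applies to it;
   no chain or product rule for higher derivatives is needed. *)
Inductive smooth_expr : (R -> R) -> Prop :=
| smooth_base f : smooth f -> smooth_expr f
| smooth_cst c : smooth_expr (cst c)
| smooth_add f g : smooth_expr f -> smooth_expr g ->
    smooth_expr (fun x => f x + g x)
| smooth_mul f g : smooth_expr f -> smooth_expr g ->
    smooth_expr (fun x => f x * g x)
| smooth_inv f : smooth_expr f -> (forall x, f x != 0) ->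
    smooth_expr (fun x => (f x)^-1)
| smooth_sqrt f : smooth_expr f -> (forall x, 0 < f x) ->
    smooth_expr (fun x => Num.sqrt (f x)).

Lemma smooth_expr_derive1 f : smooth_expr f ->
  (forall x, derivable f x 1) /\ smooth_expr f^`().
Proof.
elim => {f}.
- move=> f sf; split=> [x|]; first exact: smooth_derivable.
  exact/smooth_base/smooth_derive1.
- move=> c; split=> [x|]; first exact: derivable_cst.
  suff -> : (cst c)^`() = cst (0 : R) by exact: smooth_cst.
  by apply/funext => x; rewrite derive1_cst.
- move=> f g sf [df sf'] sg [dg sg']; split=> [x|]; first exact: derivableD.
  rewrite (_ : (fun x => _)^`() = fun x => f^`()%classic x + g^`()%classic x).
    exact: smooth_add.
  by apply/funext => x; rewrite !derive1E deriveD.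
- move=> f g sf [df sf'] sg [dg sg']; split=> [x|]; first exact: derivableM.
  rewrite (_ : (fun x => _)^`() = fun x => f x * g^`()%classic x + g x * f^`()%classic x).
    by apply: smooth_add; exact: smooth_mul.
  by apply/funext => x; rewrite !derive1E deriveM.
- move=> f sf [df sf'] f0; split=> [x|]; first exact: derivableV.
  (* The constant is written [cst (-1) x] so that the derivative is literally built from the
     constructors. *)
  rewrite (_ : (fun x => _)^`() =
      fun x => cst (-1) x * ((f x)^-1 * (f x)^-1 * f^`()%classic x)).
    apply: smooth_mul; first exact: smooth_cst.
    by apply: smooth_mul => //; apply: smooth_mul; exact: smooth_inv.
  apply/funext => x; rewrite !derive1E deriveV//= /GRing.scale/= expr2 invfM.
  by ring.
- move=> f sf [df sf'] f0.
  have D (x : R) : is_derive x (1 : R) (fun x => Num.sqrt (f x))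
      ((2 * Num.sqrt (f x))^-1 * f^`()%classic x).
    rewrite derive1E; apply: (@is_derive1_comp _ (@Num.sqrt R) f).
      exact: is_derive1_sqrt.
    exact/derivableP.
  split=> [x|]; first by case: (D x).
  rewrite (_ : (fun x => _)^`() =
     fun x => (cst 2 x * Num.sqrt (f x))^-1 * f^`()%classic x).
    apply: smooth_mul => //; apply: smooth_inv.
      by apply: smooth_mul; [exact: smooth_cst|exact: smooth_sqrt].
    by move=> x /=; rewrite mulf_neq0// gt_eqF// sqrtr_gt0.
  by apply/funext => x; rewrite derive1E; have /@derive_val := D x.
Qed.

Lemma smooth_exprW f : smooth_expr f -> smooth f.
Proof. exact/smooth_coind/smooth_expr_derive1. Qed.

(** This shape covers both the scaled mollifier and the reflected translates [psi (x - y)], and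
    differentiation preserves it, as the coinduction in [smooth_affine] requires. *)
Lemma derive1_affine f (c a b x : R) : derivable f (a * x + b) 1 ->
  is_derive x 1 (fun x => c * f (a * x + b)) (c * a * f^`()%classic (a * x + b)).
Proof.
move=> df.
have H : is_derive x 1 (fun x => f (a * x + b)) (f^`()%classic (a * x + b) * a).
  apply: (@is_derive1_comp _ f (fun x => a * x + b)).
    by rewrite derive1E; exact/derivableP.
  apply: is_derive_eq; rewrite /GRing.scale/= addr0; ring.
rewrite [X in is_derive _ _ X _](_ : _ = c \*: (fun x => f (a * x + b)))//.
by apply: is_derive_eq; rewrite /GRing.scale/=; ring.
Qed.

Lemma smooth_affine f c a b : smooth f -> smooth (fun x => c * f (a * x + b)).
Proof.
move=> sf; apply: (@smooth_coind
  (fun g => exists c f, smooth f /\ g = fun x => c * f (a * x + b))).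
  move=> _ [d [g [sg ->]]].
  have D x := @derive1_affine g d a b x (smooth_derivable sg).
  split=> [x|]; first by case: (D x).
  exists (d * a), g^`(); split; first exact: smooth_derive1.
  by apply/funext => x; rewrite derive1E; have /@derive_val := D x.
by exists c, f.
Qed.

Lemma derive1_affineE f c a b : smooth f ->
  (fun x => c * f (a * x + b))^`() = fun x => c * a * f^`()%classic (a * x + b).
Proof.
move=> sf; apply/funext => x; rewrite derive1E.
by have /@derive_val := @derive1_affine f c a b x (smooth_derivable sf).
Qed.

End smooth.

Section test_function.
Context {R : realType}.
Implicit Types psi : R -> R.

(** With a radius in place of the topological support, stability under derivation and affine maps
    becomes a matter of inequalities. The radius may be negative, hence the absolute values taken of
    it later. *)
Lemma test_functionP psi : test_function psi <->
  smooth psi /\ exists K : R, forall x : R, K < `|x| -> psi x = 0.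
Proof.
split=> [[sp /compact_bounded [K [_ bK]]]|[sp [K K0]]]; split=> //.
  exists (K + 1) => x Kx; apply/eqP/negP => /negP px.
  have : supp psi x by apply: subset_closure.
  by move=> /(bK (K + 1)); rewrite /= ltrDl ltr01 leNgt Kx => /(_ isT).
apply: (@subclosed_compact _ _ `[- K, K]).
- exact: closed_closure.
- exact: segment_compact.
- rewrite [X in _ `<=` X](closure_id _).1; last exact: itv_closed.
  apply: closureS => x /= px; rewrite in_itv/= -ler_norml leNgt.
  by apply/negP => /K0 /eqP; rewrite (negbTE px).
Qed.

Lemma test_derive1 psi : test_function psi -> test_function psi^`().
Proof.
move=> /test_functionP[sp [K K0]]; apply/test_functionP; split.
  exact: smooth_derive1.
exists K => x Kx; rewrite derive1E.
(* Derivatives are local, and [psi] vanishes on the open set [K < |y|]. *)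
rewrite (@near_eq_derive _ _ _ psi (cst 0)) ?derive_cst//.
have : open [set y : R | K < `|y|].
  apply: (@open_comp _ _ (@Num.norm _ R) [set y | K < y]).
    by move=> y _; exact: norm_continuous.
  exact: open_gt.
by move=> /(_ x Kx); apply: filterS => y /K0.
Qed.

Lemma test_affine psi c a b : a != 0 -> test_function psi ->
  test_function (fun x => c * psi (a * x + b)).
Proof.
move=> a0 /test_functionP[sp [K K0]]; apply/test_functionP; split.
  exact: smooth_affine.
exists ((K + `|b|) / `|a|) => x.
rewrite ltr_pdivrMr ?normr_gt0// => Kx.
rewrite K0 ?mulr0//.
rewrite -ltrBDr in Kx *; rewrite mulrC -normrM in Kx.
by apply: (lt_le_trans Kx); have := lerB_normD (a * x) b; rewrite lerBlDr.
Qed.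

Lemma test_bounded psi : test_function psi -> exists2 C : R, 0 <= C &
  forall x : R, `|psi x| <= C.
Proof.
move=> /test_functionP[sp [K K0]].
have /compact_bounded[C [_ bC]] : compact (psi @` `[-K, K]).
  apply: continuous_compact; last exact: segment_compact.
  exact/continuous_subspaceT/smooth_continuous.
exists (`|C| + 1) => [|x]; first by rewrite addr_ge0.
have [Kx|xK] := ltP K `|x|; first by rewrite K0// normr0 addr_ge0.
apply: (bC (`|C| + 1)).
  by rewrite (le_lt_trans (ler_norm C))// ltrDl.
by exists x => //=; rewrite in_itv/= -ler_norml.
Qed.

End test_function.

(** * Affine substitution *)

Section affine_substitution.
Context {R : realType}.
Notation lam := (@lebesgue_measure R).
Implicit Types a b : R.

Lemma measurable_affine a b (D : set R) : measurable_fun D (fun y => a * y + b).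
Proof. by apply: measurable_funD => //; apply: measurable_funM. Qed.

(** The right-hand side is a measure in [A] that agrees with Lebesgue measure on intervals []c, d]],
    so uniqueness of Lebesgue measure applies. For negative [a] the preimage is closed on the left
    instead, hence the case split on the sign. *)
Lemma lebesgue_measure_affine a b (A : set R) : a != 0 -> measurable A ->
  lam A = (`|a|%:E * lam ((fun y => a * y + b)%R @^-1` A))%E.
Proof.
move=> a0 mA; pose T : measurableTypeR R -> measurableTypeR R := fun y => a * y + b.
have mT : measurable_fun setT T by exact: measurable_affine.
pose T' : {mfun measurableTypeR R >-> measurableTypeR R} :=
  HB.pack T (isMeasurableFun.Build _ _ _ _ _ mT).
pose k := NngNum (normr_ge0 a).
apply: (@lebesgue_measure_unique _ (mscale k (pushforward lam T'))) => //.
move=> _ [[c d]] _ <-.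
transitivity (`|a|%:E * lam (T @^-1` `]c, d]))%E; last by [].
have [an|ap|az] := ltgtP a 0; last by rewrite az eqxx in a0.
- rewrite (_ : T @^-1` _ = `[(d - b) / a, (c - b) / a[).
    rewrite !lebesgue_measure_itv/= !lte_fin.
    rewrite ltr_nM2r ?invr_lt0// ltrD2r.
    case: ifPn => _; last by rewrite mule0.
    rewrite -!EFinB -EFinM; congr EFin; rewrite ltr0_norm//; field.
    by [].
  apply/seteqP; split=> y /=; rewrite !in_itv/= /T ler_ndivrMr// ltr_ndivlMr//.
    by rewrite mulrC => /andP[? ?]; apply/andP; split; lra.
  by move=> /andP[? ?]; apply/andP; split; lra.
- rewrite (_ : T @^-1` _ = `](c - b) / a, (d - b) / a]).
    rewrite !lebesgue_measure_itv/= !lte_fin.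
    rewrite ltr_pM2r ?invr_gt0// ltrD2r.
    case: ifPn => _; last by rewrite mule0.
    rewrite -!EFinB -EFinM; congr EFin; rewrite gtr0_norm//; field.
    by [].
  apply/seteqP; split=> y /=; rewrite !in_itv/= /T ltr_pdivrMr// ler_pdivlMr//.
    by rewrite mulrC => /andP[? ?]; apply/andP; split; lra.
  by move=> /andP[? ?]; apply/andP; split; lra.
Qed.

Lemma ge0_integral_affine a b (f : R -> \bar R) : a != 0 ->
  measurable_fun setT f -> (forall x, 0 <= f x)%E ->
  (\int[lam]_x f x = `|a|%:E * \int[lam]_y f (a * y + b)%R)%E.
Proof.
move=> a0 mf f0; pose T : measurableTypeR R -> measurableTypeR R := fun y => a * y + b.
have mT : measurable_fun setT T by exact: measurable_affine.
pose k := NngNum (normr_ge0 a).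
pose T' : {mfun measurableTypeR R >-> measurableTypeR R} :=
  HB.pack T (isMeasurableFun.Build _ _ _ _ _ mT).
rewrite -[X in (_ * X)%E](_ : (\int[pushforward lam T']_y f y = _)%E).
  rewrite -(ge0_integral_mscale _ _ k)//.
  apply: eq_measure_integral => A mA _.
  exact: lebesgue_measure_affine.
rewrite ge0_integral_pushforward//.
Qed.

(** Positive and negative parts transform separately by the nonnegative case. If one of them is
    infinite, [fine] returns 0 on both sides, so the identity covers non-integrable [f] too. *)
Lemma Rintegral_affine a b (f : R -> R) : a != 0 -> measurable_fun setT f ->
  \int[lam]_x f x = `|a| * \int[lam]_y f (a * y + b).
Proof.
move=> a0 mf; rewrite /Rintegral -[`|a|]/(fine `|a|%:E).
have mfE : measurable_fun setT (EFin \o f) by exact/measurable_EFinP.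
rewrite integralE (ge0_integral_affine b a0)//; last exact: measurable_funepos.
rewrite [X in (_ - X)%E](ge0_integral_affine b a0)//; last exact: measurable_funeneg.
rewrite [in RHS]integralE/=.
set p := (\int[_]_y _)%E; set q := (\int[_]_y _)%E.
have p0 : (0 <= p)%E by exact: integral_ge0.
have q0 : (0 <= q)%E by exact: integral_ge0.
rewrite [X in _ = _ * fine (X - _)%E](_ : _ = p)%E; last first.
  by apply: eq_integral => y _; rewrite (funepos_comp (EFin \o f) (fun y => a * y + b)%R).
rewrite [X in _ = _ * fine (_ - X)%E](_ : _ = q)%E; last first.
  by apply: eq_integral => y _; rewrite (funeneg_comp (EFin \o f) (fun y => a * y + b)%R).
have na : 0 < `|a| by rewrite normr_gt0.
move: p q p0 q0 => [p| |] [q| |]//= _ _; rewrite ?gt0_muley ?lte_fin//= ?mulr0//.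
by rewrite -mulrBr.
Qed.

Lemma integrable_affine a b (f : R -> R) : a != 0 ->
  lam.-integrable setT (EFin \o f) ->
  lam.-integrable setT (EFin \o (fun y => f (a * y + b))).
Proof.
move=> a0 /integrableP[mf fi]; apply/integrableP; split.
  apply/measurable_EFinP; move/measurable_EFinP in mf.
  by apply: (measurableT_comp mf); exact: measurable_affine.
move: fi; rewrite (ge0_integral_affine b a0)//; last exact: measurableT_comp.
have na : 0 < `|a| by rewrite normr_gt0.
by move=> H; apply: contraLR H; rewrite -!leNgt !leye_eq => /eqP ->; rewrite gt0_muley.
Qed.

End affine_substitution.

(** * Convolution with a test function *)

Section convolution.
Context {R : realType}.
Variable nu : {measure set (measurableTypeR R) -> \bar R}.
Implicit Types psi h : R -> R.

(** Two instances matter: Lebesgue measure with [h] equal to [u] or [u_x], and [mu] with [h]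
    constant 1, which gives the mollified measure [M_n]. *)
Definition convol psi h (x : R) : R := \int[nu]_y (psi (x - y) * h y).

(** Symmetric intervals match the radius in [test_functionP]. For Lebesgue measure,
    [loc_integrable_locally] leads back to the standard notion. *)
Definition loc_integrable h := measurable_fun setT h /\
  forall K : R, nu.-integrable `[- K, K] (EFin \o h).

Lemma measurable_reflect (x : R) psi : measurable_fun setT psi ->
  measurable_fun setT (fun y : R => psi (x - y)).
Proof. by move=> mp; apply: (measurableT_comp mp); apply: measurable_funB. Qed.

(** The dominating function for the integrand of a convolution and for its derivative: [C] will
    bound the test function, and [[-K, K]] will contain every [y] that its support can reach. *)
Lemma loc_integrable_dom h (C K : R) : loc_integrable h ->
  nu.-integrable setT (fun y => (C * ((fun y => `|h y|) \_ `[- K, K]) y)%:E).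
Proof.
move=> [_ ih]; set A : set R := [set` _].
have iA : nu.-integrable setT ((abse \o (EFin \o h)) \_ A).
  have mA : measurable (A : set (measurableTypeR R)) by exact: measurable_itv.
  apply: (@integrable_mkcond _ _ _ nu A _ mA).1.
  exact: (integrable_abse (ih K)).
rewrite (_ : (fun y => _) = fun y => (C%:E * ((abse \o (EFin \o h)) \_ A) y)%E).
  exact: integrableZl.
by apply/funext => y; rewrite !patchE; case: ifPn => _ //=; rewrite mulr0 mule0.
Qed.

Lemma convol_integrable psi h x : test_function psi -> loc_integrable h ->
  nu.-integrable setT (fun y => (psi (x - y) * h y)%:E).
Proof.
move=> tp lh; have [mh ih] := lh.
have [C C0 pC] := test_bounded tp.
have [sp [K K0]] := (test_functionP _).1 tp.
have mp : measurable_fun setT (fun y : R => psi (x - y)).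
  by apply: measurable_reflect; exact: smooth_measurable.
pose A := `[- (`|x| + K), `|x| + K] : set R.
have := @loc_integrable_dom h C (`|x| + K) lh.
apply: le_integrable => //.
  by apply/measurable_EFinP/measurable_funM.
move=> y _ /=; rewrite patchE; case: ifPn => yA.
  by rewrite lee_fin [leRHS]ger0_norm ?mulr_ge0// normrM ler_wpM2r.
rewrite K0 ?mul0r ?mulr0 ?normr0//.
move: yA; rewrite notin_setE/= in_itv/= -ler_norml => /negP; rewrite -ltNge.
rewrite -ltrBrDl => /lt_le_trans; apply.
by rewrite lerBlDr addrC -lerBlDr distrC; have := lerB_dist y x; rewrite distrC; lra.
Qed.

Lemma convol_derivable psi h x : test_function psi -> loc_integrable h ->
  derivable (convol psi h) x 1 /\ (convol psi h)^`() x = convol psi^`() h x.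
Proof.
move=> tp lh; have [mh ih] := lh.
have tp' := test_derive1 tp.
have [C C0 pC] := test_bounded tp'.
have [sp' [K K0]] := (test_functionP _).1 tp'.
have sp : smooth psi by case: tp.
pose f (x y : R) := psi (x - y) * h y.
have D (t y : R) : is_derive t (1 : R) (f ^~ y) (psi^`()%classic (t - y) * h y).
  have := @derive1_affine _ psi (h y) 1 (- y) t (smooth_derivable sp).
  rewrite !mul1r mulr1 [X in is_derive _ _ _ X]mulrC.
  congr is_derive; apply/funext => z; rewrite /f mul1r mulrC//.
(* The domination must be uniform for [t] within 1 of [x]: if [|t - y| <= K], then
   [|y| <= |x| + 1 + K]. *)
pose A := `[- (`|x| + 1 + K), `|x| + 1 + K] : set R.
pose G y := C * ((fun y => `|h y|) \_ A) y.
have G0 y : 0 <= G y.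
  by rewrite mulr_ge0//= patchE; case: ifPn => //=; rewrite normr_ge0.
have iG : nu.-integrable setT (EFin \o G).
  exact: (@loc_integrable_dom h C (`|x| + 1 + K) lh).
have fi t : `](x - 1), (x + 1)[ t -> nu.-integrable setT (EFin \o f t).
  by move=> _; exact: convol_integrable.
have df t y : `](x - 1), (x + 1)[ t -> [set: R] y -> derivable (f ^~ y) t 1.
  by move=> _ _; case: (D t y).
have bG t y : `](x - 1), (x + 1)[ t -> [set: R] y -> `|partial1of2 f t y| <= G y.
  rewrite /= in_itv/= => /andP[xt tx] _; rewrite partial1of2E.
  have /@derive_val -> := D t y.
  rewrite normrM /G/= patchE; case: ifPn => yA/=; first by rewrite ler_wpM2r.
  rewrite mulr0 K0 ?normr0 ?mul0r//.
  move: yA; rewrite notin_setE /A/= in_itv/= -ler_norml => /negP; rewrite -ltNge.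
  have tx1  : `|t| <= `|x| + 1.
    have : `|t - x| <= 1 by rewrite ler_norml; apply/andP; split; lra.
    by have := lerB_dist t x; lra.
  by have := lerB_dist y t; rewrite distrC; lra.
have xI : `](x - 1), (x + 1)[ x by rewrite /= in_itv/= ltrBlDr ltrDl ltr01.
split.
  exact: (@derivable_under_integral _ _ _ nu f setT measurableT x _ _ xI fi df
    G G0 iG bG).
rewrite (@differentiation_under_integral _ _ _ nu f setT measurableT x _ _ xI fi
  df G G0 iG bG).
apply: eq_Rintegral => y _; rewrite partial1of2E.
by have /@derive_val -> := D x y.
Qed.

Lemma convol_derive1 psi h : test_function psi -> loc_integrable h ->
  (convol psi h)^`() = convol psi^`() h.
Proof. by move=> tp lh; apply/funext => x; case: (convol_derivable x tp lh). Qed.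

Lemma convol_smooth psi h : test_function psi -> loc_integrable h ->
  smooth (convol psi h).
Proof.
move=> tp lh; apply: (@smooth_coind _
  (fun g => exists2 psi, test_function psi & g = convol psi h)); last by exists psi.
move=> _ [p {}tp ->]; split=> [x|]; first by case: (convol_derivable x tp lh).
by exists p^`(); [exact: test_derive1|exact: convol_derive1].
Qed.

Lemma convol_measurable psi h (D : set R) :
  test_function psi -> loc_integrable h -> measurable_fun D (convol psi h).
Proof. by move=> tp lh; apply: smooth_measurable; exact: convol_smooth. Qed.

End convolution.

Section convolution_theory.
Context {R : realType}.
Variable nu : {measure set (measurableTypeR R) -> \bar R}.
Implicit Types psi f g h : R -> R.

Lemma loc_integrableD f g : loc_integrable nu f -> loc_integrable nu g ->
  loc_integrable nu (fun y => f y + g y).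
Proof.
move=> [mf jf] [mg jg]; split=> [|K]; first exact: measurable_funD.
rewrite (_ : _ \o _ = ((EFin \o f) \+ (EFin \o g))%E)//.
by apply: integrableD.
Qed.

Lemma loc_integrableZ (c : R) f : loc_integrable nu f ->
  loc_integrable nu (fun y => c * f y).
Proof.
move=> [mf jf]; split=> [|K]; first exact: measurable_funM.
rewrite (_ : _ \o _ = (fun x => c%:E * (EFin \o f) x)%E)//.
by apply: integrableZl.
Qed.

Lemma convolD psi f g x : test_function psi ->
  loc_integrable nu f -> loc_integrable nu g ->
  convol nu psi (fun y => f y + g y) x = convol nu psi f x + convol nu psi g x.
Proof.
move=> tp lf lg; rewrite /convol -RintegralD//; [|exact: convol_integrable..].
by apply: eq_Rintegral => y _; rewrite mulrDr.
Qed.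

Lemma convolZ psi c f x : test_function psi -> loc_integrable nu f ->
  convol nu psi (fun y => c * f y) x = c * convol nu psi f x.
Proof.
move=> tp lf; rewrite /convol -RintegralZl//; last exact: convol_integrable.
by apply: eq_Rintegral => y _; rewrite mulrCA.
Qed.

Lemma convol_ge0 psi f x : (forall y, 0 <= psi y) -> (forall y, 0 <= f y) ->
  0 <= convol nu psi f x.
Proof. by move=> p0 f0; apply: Rintegral_ge0 => y _; rewrite mulr_ge0. Qed.

End convolution_theory.

(** * Tonelli's theorem for convolutions *)

Section tonelli.
Context {R : realType}.
Notation lam := (@lebesgue_measure R).
Variable nu : {sigma_finite_measure set (measurableTypeR R) -> \bar R}.
Implicit Types psi f g h : R -> R.

Lemma tonelli_convol psi h (D : set R) : measurable D ->
  measurable_fun setT psi -> (forall y, 0 <= psi y) ->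
  measurable_fun setT h -> (forall y, 0 <= h y) ->
  (\int[lam]_(x in D) \int[nu]_y (psi (x - y) * h y)%:E =
   \int[nu]_y ((\int[lam]_(x in D) (psi (x - y))%:E) * (h y)%:E))%E.
Proof.
move=> mD mp p0 mh h0.
(* The domain [D] enters as an indicator, so that Tonelli applies on the whole product space. *)
pose f (z : measurableTypeR R * measurableTypeR R) : \bar R :=
  (psi (z.1 - z.2) * h z.2 * \1_D z.1)%:E.
have mf : measurable_fun setT f.
  apply/measurable_EFinP; apply: measurable_funM.
    apply: measurable_funM.
      by apply: (measurableT_comp mp); apply: measurable_funB.
    exact: (measurableT_comp mh).
  by apply: (measurableT_comp (measurable_indic _)).
have f0 z : (0 <= f z)%E by rewrite lee_fin !mulr_ge0.
have := @fubini_tonelli _ _ _ _ R lam nu f mf f0.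
rewrite /f/= => fub.
rewrite integral_mkcond.
transitivity (\int[lam]_x \int[nu]_y (psi (x - y) * h y * \1_D x)%:E)%E.
  apply: eq_integral => x _; rewrite patchE indicE; case: ifPn => _.
    by apply: eq_integral => y _; rewrite mulr1.
  by under eq_integral do rewrite mulr0; rewrite integral0.
rewrite fub; apply: eq_integral => y _.
rewrite [in RHS]integral_mkcond -ge0_integralZr//=.
- apply: eq_integral => x _; rewrite patchE indicE; case: ifPn => _ /=.
    by rewrite mulr1.
  by rewrite mulr0 mul0e.
- apply/(measurable_restrictT _ _).1 => //; apply/measurable_EFinP.
  by apply: measurable_funTS; apply: (measurableT_comp mp); apply: measurable_funB.
- by move=> x _; rewrite patchE; case: ifPn => //= _; rewrite lee_fin.
- by rewrite lee_fin.
Qed.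

Lemma measurable_convol psi h :
  measurable_fun setT psi -> (forall y, 0 <= psi y) ->
  measurable_fun setT h -> (forall y, 0 <= h y) ->
  measurable_fun setT (fun x : R => \int[nu]_y (psi (x - y) * h y)%:E)%E.
Proof.
move=> mp p0 mh h0.
apply: (@measurable_fun_fubini_tonelli_F _ _ _ _ _ nu
  (fun z : measurableTypeR R * measurableTypeR R => (psi (z.1 - z.2) * h z.2)%:E)).
  apply/measurable_EFinP; apply: measurable_funM.
    by apply: (measurableT_comp mp); apply: measurable_funB.
  exact: (measurableT_comp mh).
by move=> z; rewrite lee_fin mulr_ge0.
Qed.

(** This is a section integral on the product space. For the mollifier it is the share of a point
    mass at [y] that mollification sends into [D]. *)
Lemma measurable_integral_translate psi (D : set R) : measurable D ->
  measurable_fun setT psi -> (forall y, 0 <= psi y) ->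
  measurable_fun setT (fun y : R => \int[lam]_(x in D) (psi (x - y))%:E)%E.
Proof.
move=> mD mp p0.
pose f (z : measurableTypeR R * measurableTypeR R) : \bar R :=
  (psi (z.1 - z.2) * \1_D z.1)%:E.
have mf : measurable_fun setT f.
  apply/measurable_EFinP; apply: measurable_funM.
    by apply: (measurableT_comp mp); apply: measurable_funB.
  by apply: (measurableT_comp (measurable_indic _)).
have f0 z : (0 <= f z)%E by rewrite lee_fin mulr_ge0.
have := @measurable_fun_fubini_tonelli_G _ _ _ _ _ lam f mf f0.
congr measurable_fun; apply/funext => y.
rewrite /fubini_G [RHS]integral_mkcond; apply: eq_integral => x _.
by rewrite patchE /f/= indicE; case: ifPn => _; rewrite ?mulr1 ?mulr0.
Qed.

End tonelli.

(** * Square-integrable functions *)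

Section square_integrable.
Context {R : realType}.
Notation lam := (@lebesgue_measure R).
Implicit Types psi f g h : R -> R.

Lemma L2P f : L2 f <-> measurable_fun setT f /\
  lam.-integrable setT (EFin \o (fun x => f x ^+ 2)).
Proof.
split=> [Lf|[mf /integrableP[_ fi]]].
  split; last exact: Lfun2_integrable_sqr.
  by move: Lf; rewrite /L2 inE => /andP[/[!inE]].
rewrite /L2 inE; apply/andP; rewrite !inE/=; split=> //.
rewrite /finite_norm unlock; apply: poweR_lty.
apply: le_lt_trans fi; apply: ge0_le_integral => //.
- by move=> x _; exact: poweR_ge0.
- apply/measurable_EFinP; apply: (measurableT_comp (measurable_powR _)).
  exact: measurableT_comp.
- apply: measurableT_comp => //; apply/measurable_EFinP.
  exact: measurable_funX.
- by move=> x _ /=; rewrite lee_fin powR_mulrn// normrX.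
Qed.

Lemma lebesgue_measure_cc_lty (a b : R) : (lam `[a, b] < +oo)%E.
Proof. by rewrite lebesgue_measure_itv/=; case: ifPn => _; rewrite ?ltry. Qed.

Lemma L2_loc_integrable f : L2 f -> loc_integrable lam f.
Proof.
move=> /L2P[mf fi]; split=> // K.
have mK : measurable (`[- K, K] : set R) by [].
(* Domination by [|f| <= 1 + f^2], whose right side is integrable on a bounded interval. *)
have : lam.-integrable `[- K, K] (fun x => (1%:E + (f x ^+ 2)%:E)%E).
  apply: integrableD => //; last exact: (integrableS measurableT).
  apply/integrableP; split => //.
  under eq_integral do rewrite abse1.
  by rewrite integral_cst//= mul1e; exact: lebesgue_measure_cc_lty.
apply: le_integrable => //; first exact/measurable_EFinP/measurable_funTS.
move=> x _ /=; rewrite lee_fin [leRHS]ger0_norm ?addr_ge0 ?sqr_ge0//.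
rewrite -[f x ^+ 2]real_normK ?num_real//.
have := sqr_ge0 (`|f x| - 1); have := normr_ge0 (f x).
by nra.
Qed.

Lemma L2_mul_integrable f g : L2 f -> L2 g ->
  lam.-integrable setT (EFin \o (fun x => f x * g x)).
Proof. by move=> Lf Lg; apply/Lfun1_integrable; exact: Lfun2_mul_Lfun1. Qed.

Lemma L2D f g : L2 f -> L2 g -> L2 (fun x => f x + g x).
Proof. move=> Lf Lg; have p1 : (1 <= 2%:E :> \bar R)%E by rewrite lee_fin ler1n.
exact: ((Lfun_addr_closed lam p1).2 _ _ Lf Lg). Qed.

Lemma L2Z c f : L2 f -> L2 (fun x => c * f x).
Proof.
move=> /L2P[mf fi]; apply/L2P; split; first exact: measurable_funM.
rewrite (_ : _ \o _ = fun x => ((c ^+ 2)%:E * (f x ^+ 2)%:E)%E).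
  exact: integrableZl.
by apply/funext => x /=; rewrite exprMn.
Qed.

Lemma L2B f g : L2 f -> L2 g -> L2 (fun x => f x - g x).
Proof.
move=> Lf Lg; rewrite (_ : (fun x => _) = fun x => f x + (-1) * g x).
  by apply: L2D => //; exact: L2Z.
by apply/funext => x; rewrite mulN1r.
Qed.

Lemma test_L2 psi : test_function psi -> L2 psi.
Proof.
move=> tp; have [C C0 pC] := test_bounded tp.
have [sp [K K0]] := (test_functionP _).1 tp.
apply/L2P; split; first exact: smooth_measurable.
rewrite (_ : _ \o _ = (EFin \o (fun x => psi x ^+ 2)) \_ `[- K, K]).
  apply: (@integrable_mkcond _ _ _ lam _ _ (measurable_itv _)).1.
  apply: measurable_bounded_integrable => //.
  - exact: lebesgue_measure_cc_lty.
  - by apply: measurable_funX; exact: smooth_measurable.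
  - exists (C ^+ 2); split; first exact: num_real.
    move=> z Cz x _ /=; apply: le_trans (ltW Cz).
    by rewrite normrX lerXn2r ?nnegrE.
apply/funext => x; rewrite patchE; case: ifPn => //=.
rewrite notin_setE/= in_itv/= -ler_norml => /negP; rewrite -ltNge => /K0 ->.
by rewrite expr0n.
Qed.

End square_integrable.

(** * Mollification *)

Section mollifier.
Context {R : realType}.
Notation lam := (@lebesgue_measure R).
Variable phi : R -> R.
Hypothesis hphi : friedrichs_mollifier phi.
Implicit Types (psi f g h : R -> R) (c : R).

(** The scale is a real parameter, so the same lemmas serve both [n] positive and [n.+1]. *)
Definition moll c (z : R) : R := c * phi (c * z).

Let phi_test : test_function phi. Proof. by case: hphi. Qed.

Let phi_ge0 z : 0 <= phi z. Proof. by case: hphi => _ /(_ z)[]. Qed.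

Let phi_meas : measurable_fun setT phi.
Proof. by apply: smooth_measurable; case: phi_test. Qed.

Let phi_supp z : 1 < `|z| -> phi z = 0.
Proof.
case: hphi => _ _ _ _ sE z1; apply/eqP/negP => /negP pz.
have : supp phi z by apply: subset_closure.
by rewrite sE/= in_itv/= -ler_norml leNgt z1.
Qed.

Lemma mollifier_integral : (\int[lam]_z (phi z)%:E = 1)%E.
Proof.
case: hphi => _ _ h _ _; rewrite -h Lnorm1.
by apply: eq_integral => z _; rewrite /= ger0_norm.
Qed.

Lemma moll_test c : 0 < c -> test_function (moll c).
Proof.
move=> c0; have := @test_affine _ phi c c 0 (lt0r_neq0 c0) phi_test.
by congr test_function; apply/funext => z; rewrite addr0.
Qed.

Lemma moll_ge0 c z : 0 < c -> 0 <= moll c z.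
Proof. by move=> c0; rewrite mulr_ge0// ltW. Qed.

Lemma moll_supp c z : 0 < c -> 1 < c * `|z| -> moll c z = 0.
Proof.
by move=> c0 cz; rewrite /moll phi_supp ?mulr0// normrM gtr0_norm.
Qed.

Lemma moll_measurable c : 0 < c -> measurable_fun setT (moll c).
Proof. by move=> c0; apply: smooth_measurable; case: (moll_test c0). Qed.

Lemma moll_bounded : exists2 C : R, 0 <= C & forall c z, 0 < c -> moll c z <= C * c.
Proof.
have [C C0 pC] := test_bounded phi_test; exists C => // c z c0.
rewrite /moll mulrC; apply: ler_wpM2r; first exact: ltW.
exact: le_trans (ler_norm _) (pC _).
Qed.

Let moll_affine c a b : 0 < c -> `|a| = c ->
  (\int[lam]_y (c * phi (a * y + b))%:E = 1)%E.
Proof.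
move=> c0 ac; have a0 : a != 0 by rewrite -normr_gt0 ac.
have mphi : measurable_fun setT (EFin \o phi) by exact/measurable_EFinP.
rewrite -mollifier_integral (ge0_integral_affine b a0 mphi); last first.
  by move=> x; rewrite lee_fin.
rewrite ac -ge0_integralZl//.
- by apply: measurable_funTS; apply: (measurableT_comp mphi); exact: measurable_affine.
- by move=> x _; rewrite lee_fin.
- by rewrite lee_fin ltW.
Qed.

Lemma moll_integral c x : 0 < c -> (\int[lam]_y (moll c (x - y))%:E = 1)%E.
Proof.
move=> c0; have := @moll_affine c (- c) (c * x) c0.
rewrite normrN gtr0_norm// => /(_ erefl) <-.
by apply: eq_integral => y _; rewrite /moll mulrBr addrC mulNr.
Qed.

Lemma moll_integralr c y : 0 < c -> (\int[lam]_x (moll c (x - y))%:E = 1)%E.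
Proof.
move=> c0; have := @moll_affine c c (- (c * y)) c0.
rewrite gtr0_norm// => /(_ erefl) <-.
by apply: eq_integral => x _; rewrite /moll mulrBr.
Qed.

Lemma convol_EFin (nu : {measure set (measurableTypeR R) -> \bar R}) psi h x :
  test_function psi -> loc_integrable nu h ->
  (convol nu psi h x)%:E = (\int[nu]_y (psi (x - y) * h y)%:E)%E.
Proof.
move=> tp lh; rewrite fineK//.
exact: (integrable_fin_num measurableT (convol_integrable x tp lh)).
Qed.

Lemma loc_integrable_cst c : loc_integrable lam (cst c).
Proof.
split=> [|K]; first exact: measurable_cst.
apply: measurable_bounded_integrable => //; first exact: lebesgue_measure_cc_lty.
by exists `|c|; split; [exact: num_real|move=> z Cz x _ /=; exact: ltW].
Qed.

Lemma convol_moll_cst c a x : 0 < c -> convol lam (moll c) (cst a) x = a.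
Proof.
move=> c0; rewrite (_ : cst a = fun y => a * cst 1 y); last first.
  by apply/funext => y; rewrite mulr1.
rewrite convolZ; [|exact: moll_test|exact: loc_integrable_cst].
suff -> : convol lam (moll c) (cst 1) x = 1 by rewrite mulr1.
rewrite /convol /Rintegral; under eq_integral do rewrite mulr1.
by rewrite moll_integral.
Qed.

Lemma loc_integrable_integrable (nu : {measure set (measurableTypeR R) -> \bar R}) f :
  nu.-integrable setT (EFin \o f) -> loc_integrable nu f.
Proof.
move=> fi; split; first by apply/measurable_EFinP; case/integrableP : fi.
by move=> K; exact: (integrableS measurableT).
Qed.

Lemma L2_loc_integrable_sqr f : L2 f -> loc_integrable lam (fun y => f y ^+ 2).
Proof. by move=> /L2P[_ ?]; exact: loc_integrable_integrable. Qed.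

(* The variance of f under the probability density [moll c (x - y) dy] is
   nonnegative. *)
Lemma convol_jensen c f x : 0 < c -> L2 f ->
  convol lam (moll c) f x ^+ 2 <= convol lam (moll c) (fun y => f y ^+ 2) x.
Proof.
move=> c0 Lf; set m := convol lam (moll c) f x.
have tm := moll_test c0.
have lf := L2_loc_integrable Lf.
have lf2 := L2_loc_integrable_sqr Lf.
have : 0 <= convol lam (moll c) (fun y => (f y - m) ^+ 2) x.
  by apply: convol_ge0 => y; [exact: moll_ge0|exact: sqr_ge0].
rewrite (_ : (fun y => (f y - m) ^+ 2) =
  fun y => f y ^+ 2 + ((-2 * m) * f y + cst (m ^+ 2) y)); last first.
  by apply/funext => y /=; ring.
have l1 := @loc_integrableZ _ lam (-2 * m) f lf.
have l2 := loc_integrable_cst (m ^+ 2).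
rewrite convolD//; last exact: loc_integrableD.
rewrite convolD// convolZ// convol_moll_cst// -/m.
by nra.
Qed.

(** Jensen holds pointwise; after Tonelli the kernel is integrated in [x] first and contributes a
    factor 1. *)
Lemma convol_L2_le c f : 0 < c -> L2 f ->
  (\int[lam]_x (convol lam (moll c) f x ^+ 2)%:E <= \int[lam]_x (f x ^+ 2)%:E)%E.
Proof.
move=> c0 Lf; have tm := moll_test c0.
have lf := L2_loc_integrable Lf.
have lf2 := L2_loc_integrable_sqr Lf.
have mm := moll_measurable c0.
apply: (@le_trans _ _ (\int[lam]_x (\int[lam]_y (moll c (x - y) * f y ^+ 2)%:E))%E).
  apply: ge0_le_integral => //.
  - by move=> x _; rewrite lee_fin sqr_ge0.
  - apply/measurable_EFinP; apply: measurable_funX.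
    exact: convol_measurable.
  - apply: measurable_convol => //.
    + by move=> y; exact: moll_ge0.
    + by case: lf2.
    + by move=> y; exact: sqr_ge0.
  - by move=> x _; rewrite -convol_EFin// lee_fin convol_jensen.
rewrite (@tonelli_convol _ lam (moll c) (fun y => f y ^+ 2) setT)//.
- rewrite le_eqVlt; apply/orP; left; apply/eqP/eq_integral => y _.
  by rewrite moll_integralr// mul1e.
- by move=> y; exact: moll_ge0.
- by case: lf2.
- by move=> y; exact: sqr_ge0.
Qed.

Lemma L2_convol c f : 0 < c -> L2 f -> L2 (convol lam (moll c) f).
Proof.
move=> c0 Lf; apply/L2P.
have ms : measurable_fun setT (convol lam (moll c) f).
  apply: convol_measurable; first exact: moll_test.
  exact: L2_loc_integrable.
split=> //; apply/integrableP; split.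
  by apply/measurable_EFinP; exact: measurable_funX.
under eq_integral do rewrite /= ger0_norm ?sqr_ge0//.
apply: le_lt_trans (convol_L2_le c0 Lf) _.
move/L2P : Lf => [_ /integrableP[_]].
by under eq_integral do rewrite /= ger0_norm ?sqr_ge0//.
Qed.

End mollifier.

(** * Convergence of mollifications and weak derivatives *)

Section approximate_identity.
Context {R : realType}.
Notation lam := (@lebesgue_measure R).
Variable phi : R -> R.
Hypothesis hphi : friedrichs_mollifier phi.
Implicit Types (psi f g h u v w : R -> R) (c : R).

Lemma loc_integrable_locally f : loc_integrable lam f -> locally_integrable setT f.
Proof.
move=> [mf fi]; split=> //; first exact: openT.
move=> K _ cK; have [M [_ bM]] := compact_bounded cK.
have mK : measurable K by exact: compact_measurable.
have /integrableP[_] := fi (`|M| + 1); apply: le_lt_trans.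
apply: ge0_subset_integral => //.
  by apply/measurable_EFinP; apply: measurableT_comp => //; exact: measurable_funTS.
move=> x Kx /=; rewrite in_itv/= -ler_norml; apply: bM => //.
by rewrite (le_lt_trans (ler_norm M))// ltrDl.
Qed.

(** The kernel has integral 1, so the error is the convolution of [f - f x]. The kernel is at most
    [C * c] and vanishes off a ball of measure [4 / c], so the error is at most [4 * C] times the
    average of [|f - f x|] over that ball, which tends to 0 at a Lebesgue point. *)
Lemma convol_lebesgue_pt f x : loc_integrable lam f -> lebesgue_pt f x ->
  convol lam (moll phi n.+1%:R) f x @[n --> \oo] --> f x.
Proof.
move=> lf fx; apply/subr_cvg0; apply: norm_cvg0.
have [C C0 hC] := moll_bounded hphi.
(* Twice the support radius: off this open ball [c * |x - y|] is at least 2, while [moll_supp] asks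
   for strictly more than 1. *)
pose r n : R := 2 / n.+1%:R.
have dr : davg f x (r n) @[n --> \oo] --> 0%E.
  apply: ((cvge_at_rightP _ _ _).1 fx); split=> [n|].
    by rewrite divr_gt0.
  rewrite -[X in _ --> X](mulr0 2); apply: cvgM; first exact: cvg_cst.
  exact: cvg_harmonic.
have dr4 : ((4 * C)%:E * davg f x (r n))%E @[n --> \oo] --> 0%E.
  by rewrite -[X in _ --> X](mule0 (4 * C)%:E); exact: cvgeZl.
apply: (@fine_cvg _ _ _ _ (fun n => `|convol lam (moll phi n.+1%:R) f x - f x|%:E)).
apply: squeeze_cvge dr4; last exact: cvg_cst.
apply: nearW => n; rewrite lee_fin normr_ge0/=.
have c0 : (0 : R) < n.+1%:R by [].
set c : R := n.+1%:R in c0 *.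
have tm := moll_test hphi c0.
pose h y := f y + cst (- f x) y.
have lh : loc_integrable lam h.
  by apply: loc_integrableD => //; exact: loc_integrable_cst.
have -> : convol lam (moll phi c) f x - f x = convol lam (moll phi c) h x.
  by rewrite convolD//; [rewrite convol_moll_cst|exact: loc_integrable_cst].
have mh : measurable_fun setT h by case: lh.
have mm : measurable_fun setT (fun y : R => moll phi c (x - y)).
  by apply: measurable_reflect; exact: moll_measurable.
have rc0 : 0 <= r n by rewrite divr_ge0.
rewrite -[(`|_|%:E)]/(`|(convol lam (moll phi c) h x)%:E|%E) convol_EFin//.
apply: le_trans; first apply: le_abse_integral => //.
  by apply/measurable_EFinP; exact: measurable_funM.
apply: (@le_trans _ _ (\int[lam]_(y in ball x (r n)) ((C * c)%:E * `|(h y)%:E|))%E).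
  rewrite [leRHS]integral_mkcond; apply: ge0_le_integral => //.
  - by apply/measurable_EFinP; apply: measurableT_comp => //; exact: measurable_funM.
  - have mB : measurable (ball x (r n)) by exact: measurable_ball.
    apply/(measurable_restrictT _ _).1 => //.
    apply: emeasurable_funM => //; apply/measurable_EFinP.
    by apply: measurableT_comp => //; exact: measurable_funTS.
  - move=> y _; rewrite patchE; case: ifPn => xy.
      rewrite lee_fin normrM ler_wpM2r// ger0_norm ?hC//.
      exact: moll_ge0.
    rewrite (moll_supp hphi c0); first by rewrite mul0r abse0.
    move: xy; rewrite notin_setE /ball/= => /negP; rewrite -leNgt /r -/c.
    by rewrite ler_pdivrMr// mulrC => h2; apply: lt_le_trans h2; rewrite ltr1n.
rewrite ge0_integralZl//; last 3 first.
- exact: measurable_ball.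
- by apply/measurable_EFinP; apply: measurableT_comp => //; exact: measurable_funTS.
- by rewrite lee_fin mulr_ge0// ltW.
rewrite /davg /iavg lebesgue_measure_ball// inver ifF; last first.
  by apply/negbTE; rewrite mulrn_eq0/= mulf_neq0 ?invr_neq0 ?gt_eqF.
rewrite muleA -EFinM.
rewrite (_ : 4 * C * _ = C * c)//.
rewrite /r -/c -mulr_natr; field.
by rewrite gt_eqF.
Qed.

(* Parallelogram identity plus Fatou: [int (g_n + f)^2 + int (g_n - f)^2
   = 2 int g_n^2 + 2 int f^2 <= 4 int f^2 <= liminf int (g_n + f)^2]. *)
Lemma convol_L2_cvg f : L2 f ->
  \int[lam]_x ((convol lam (moll phi n.+1%:R) f x - f x) ^+ 2) @[n --> \oo] --> 0.
Proof.
move=> Lf; have lf := L2_loc_integrable Lf.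
pose g n := convol lam (moll phi n.+1%:R) f.
have Lg n : L2 (g n) by apply: L2_convol.
have isq h : L2 h -> lam.-integrable setT (EFin \o (fun x => h x ^+ 2)).
  by move=> /L2P[].
have mL2 h : L2 h -> measurable_fun setT h by move=> /L2P[].
pose I := \int[lam]_x (f x ^+ 2).
pose a n := \int[lam]_x (g n x ^+ 2).
pose s n := \int[lam]_x ((g n x + f x) ^+ 2).
pose e n := \int[lam]_x ((g n x - f x) ^+ 2).
have aI n : a n <= I.
  apply: fine_le; [exact: (integrable_fin_num measurableT (isq _ (Lg n)))|
    exact: (integrable_fin_num measurableT (isq _ Lf))|].
  exact: convol_L2_le.
have se n : s n + e n = 2 * a n + 2 * I.
  rewrite /s /e /a /I -RintegralD//; [|exact/isq/L2D|exact/isq/L2B].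
  rewrite -!RintegralZl//; [|exact: isq..].
  rewrite -RintegralD//.
  - by apply: eq_Rintegral => x _; ring.
  - exact: (@integrableZl _ _ _ lam setT measurableT 2 _ (isq _ (Lg n))).
  - exact: (@integrableZl _ _ _ lam setT measurableT 2 _ (isq _ Lf)).
have e0 n : 0 <= e n by apply: Rintegral_ge0 => x _; exact: sqr_ge0.
(* Off the null set [A] every point is a Lebesgue point of [f], so the pointwise limit in Fatou's
   lemma exists everywhere on the complement, and no integral changes. *)
have [A [mA A0 bA]] := lebesgue_differentiation (loc_integrable_locally lf).
have intD h : lam.-integrable setT (EFin \o h) ->
    (\int[lam]_(x in ~` A) (h x)%:E)%E = (\int[lam]_x h x)%:E.
  move=> ih; rewrite fineK; last exact: (integrable_fin_num measurableT ih).
  rewrite -setTD.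
  by rewrite -(@negligible_integral _ _ _ lam setT A (EFin \o h) mA measurableT ih A0).
have fat : ((4 * I)%:E <= limn_einf (fun n => (s n)%:E))%E.
  have := @fatou _ _ _ lam (~` A) (measurableC mA)
    (fun n x => ((g n x + f x) ^+ 2)%:E).
  have -> : (fun n => \int[lam]_(x in ~` A) ((g n x + f x) ^+ 2)%:E)%E =
      (fun n => (s n)%:E).
    by apply/funext => n; rewrite (intD (fun x => (g n x + f x) ^+ 2))//; exact/isq/L2D.
  move=> H; apply: le_trans (H _ _).
  - rewrite /I -RintegralZl//; last exact: isq.
    rewrite -(intD (fun x => 4 * f x ^+ 2)); last first.
      exact: (@integrableZl _ _ _ lam setT measurableT 4 _ (isq _ Lf)).
    rewrite le_eqVlt; apply/orP; left; apply/eqP/eq_integral => x /set_mem/= xA.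
    have fx : lebesgue_pt f x by apply: contrapT => nf; exact/xA/bA.
    apply/esym; apply: (cvg_limn_einf_sup _).1; apply: cvg_EFin.
      by apply: nearW.
    have gf := convol_lebesgue_pt lf fx.
    rewrite (_ : 4 * f x ^+ 2 = (f x + f x) * (f x + f x)); last by ring.
    by apply: cvgM; apply: cvgD => //; exact: cvg_cst.
  - move=> n; apply/measurable_EFinP/measurable_funX/measurable_funTS.
    by apply: measurable_funD; exact: mL2.
  - by move=> n x _; rewrite lee_fin sqr_ge0.
apply/cvgrPdist_lt => eps eps0.
have : ((4 * I - eps)%:E < limn_einf (fun n => (s n)%:E))%E.
  by apply: lt_le_trans fat; rewrite lte_fin ltrBlDr ltrDl.
(* The lower limit is the supremum of the tail infima, so on some tail [s n > 4 * I - eps]; then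
   [e n = 2 * a n + 2 * I - s n < eps] because [a n <= I]. *)
rewrite limn_einf_lim (_ : limn _ = ereal_sup (range (einfs (fun n => (s n)%:E)))).
  move=> /ereal_sup_gt[_ [N _ <-]] sN.
  exists N => // n /= Nn; rewrite sub0r normrN -/(e n) ger0_norm//.
  have : (4 * I - eps < s n).
    rewrite -lte_fin; apply: lt_le_trans sN _; apply: ereal_inf_lbound.
    by exists n.
  by have := se n; have := aI n; lra.
by apply/cvg_lim => //; exact: cvg_einfs_sup.
Qed.

Lemma test_reflect psi (x : R) : test_function psi ->
  test_function (fun y => psi (x - y)).
Proof.
have N1 : (-1 : R) != 0 by rewrite oppr_eq0 oner_eq0.
move=> /(@test_affine _ psi 1 (-1) x N1).
by congr test_function; apply/funext => y; rewrite mul1r mulN1r addrC.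
Qed.

Lemma derive1_reflect psi (x : R) : smooth psi ->
  (fun y => psi (x - y))^`() = fun y => - psi^`()%classic (x - y).
Proof.
move=> /(@derive1_affineE _ psi 1 (-1) x).
rewrite (_ : (fun y => 1 * _) = fun y => psi (x - y)); last first.
  by apply/funext => y; rewrite mul1r mulN1r addrC.
by move=> ->; apply/funext => y; rewrite mul1r !mulN1r addrC.
Qed.

(** The difference is orthogonal to every test function, in particular to the mollifier centred at
    [x]. So its mollifications vanish identically, yet they converge to it at each Lebesgue
    point. *)
Lemma weak_derivative_unique u v w : L2 v -> L2 w ->
  weak_derivative u v -> weak_derivative u w ->
  {ae lam, forall x, v x = w x}.
Proof.
move=> Lv Lw uv uw; pose g x := v x - w x.
have Lg : L2 g by exact: L2B.
have lg := L2_loc_integrable Lg.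
have g0 psi : test_function psi -> \int[lam]_y (psi y * g y) = 0.
  move=> tp; have Lp := test_L2 tp.
  rewrite (_ : \int[lam]_y _ =
      \int[lam]_y (v y * psi y) - \int[lam]_y (w y * psi y)).
    by apply/eqP; rewrite subr_eq0 -(inj_eq oppr_inj) -uv// -uw.
  rewrite -RintegralB//; [|exact: L2_mul_integrable..].
  by apply: eq_Rintegral => y _; rewrite /g mulrC mulrBl.
have lp := lebesgue_differentiation (loc_integrable_locally lg).
have F := ae_filter_ringOfSetsType (@lebesgue_measure R).
apply: (@filterS _ _ F) lp => x /(convol_lebesgue_pt lg).
rewrite (_ : (fun n => _) = cst 0); last first.
  by apply/funext => n; apply: (g0 (fun y => moll phi n.+1%:R (x - y)));
    apply: test_reflect; exact: moll_test.
move=> /cvg_lim; rewrite lim_cst// => /(_ (@Rhausdorff R))/esym/eqP.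
by rewrite subr_eq0 => /eqP.
Qed.

(** The test function is [psi (x - y)] in [y]; the sign from its derivative cancels the one in the
    definition of the weak derivative. *)
Lemma weak_derivative_convol u v psi x : L2 u -> L2 v ->
  weak_derivative u v -> test_function psi ->
  convol lam psi^`() u x = convol lam psi v x.
Proof.
move=> Lu Lv uv tp; have := uv _ (test_reflect x tp).
rewrite derive1_reflect; last by case: tp.
have lu := L2_loc_integrable Lu.
have iu := convol_integrable x (test_derive1 tp) lu.
rewrite (_ : \int[lam]_y (u y * _) = - convol lam psi^`() u x).
  move=> /oppr_inj ->; apply: eq_Rintegral => y _.
  by rewrite mulrC.
rewrite -[RHS]mulN1r -RintegralZl//.
by apply: eq_Rintegral => y _; rewrite mulN1r mulrN mulrC.
Qed.

Lemma smooth_weak_derivative g : smooth g -> weak_derivative g g^`().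
Proof.
move=> sg psi tp; have [sp [K K0]] := (test_functionP _).1 tp.
have [_ [K' K'0]] := (test_functionP _).1 (test_derive1 tp).
(* Beyond both support radii, so the boundary terms vanish, and positive, so the interval is
   nondegenerate. *)
pose M : R := `|K| + `|K'| + 1.
have M0 : 0 < M by rewrite ltr_wpDl ?addr_ge0.
have KM x : M <= `|x| -> psi x = 0.
  by move=> Mx; apply: K0; have := ler_norm K; have := normr_ge0 K'; rewrite /M in Mx; lra.
have KM' x : M <= `|x| -> psi^`() x = 0.
  by move=> Mx; apply: K'0; have := ler_norm K'; have := normr_ge0 K; rewrite /M in Mx; lra.
have restr h1 h2 : (forall x, M < `|x| -> h2 x = 0) ->
    \int[lam]_x (h1 x * h2 x) = \int[lam]_(x in `[- M, M]) (h1 x * h2 x).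
  move=> h20; rewrite [RHS]Rintegral_mkcond; apply: eq_Rintegral => x _.
  rewrite patchE; case: ifPn => //.
  rewrite notin_setE/= in_itv/= -ler_norml => /negP; rewrite -ltNge => /h20 ->.
  by rewrite mulr0.
have sD f : smooth f -> derivable_oo_LRcontinuous f (- M) M.
  move=> sf; split=> [x _| |]; first exact: smooth_derivable.
    by apply: cvg_at_right_filter; exact: smooth_continuous.
  by apply: cvg_at_left_filter; exact: smooth_continuous.
rewrite restr; last by move=> x /ltW/KM'.
rewrite restr; last by move=> x /ltW/KM.
rewrite (@Rintegration_by_parts _ g psi g^`() psi^`() (- M) M)//.
- have MM : M <= `|M| by exact: ler_norm.
  by rewrite (KM M)// (KM (- M)) ?normrN// !mulr0 subrr sub0r.
- by rewrite gtrN.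
- exact/continuous_subspaceT/smooth_continuous/smooth_derive1.
- exact: sD.
- exact/continuous_subspaceT/smooth_continuous/smooth_derive1.
- exact: sD.
Qed.

End approximate_identity.

(** * Measures with a density *)

Section density.
Context {R : realType}.
Notation lam := (@lebesgue_measure R).
Implicit Types (f g h u v : R -> R).

Section density_measure.
Variable g : R -> R.
Hypothesis g0 : forall x, 0 <= g x.
Hypothesis gi : lam.-integrable setT (EFin \o g).

Let mg (D : set R) : measurable_fun D (EFin \o g).
Proof. by apply: measurable_funTS; case/integrableP : gi. Qed.

Let density_measure0 : density_measure g set0 = 0%E.
Proof. by rewrite /density_measure integral_set0. Qed.

Let density_measure_ge0 A : (0 <= density_measure g A)%E.
Proof. by apply: integral_ge0 => x _; rewrite lee_fin. Qed.

Let density_measure_sigma_additive : semi_sigma_additive (density_measure g).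
Proof.
move=> /= F mF tF mUF; rewrite /density_measure; apply: cvg_toP.
  apply: ereal_nondecreasing_is_cvgn => m n mn.
  apply: lee_sum_nneg_natr => // k _ _; apply: integral_ge0 => /= x Fkx.
  by rewrite lee_fin.
rewrite ge0_integral_bigcup//=.
- exact: mg.
- by move=> x _; rewrite lee_fin.
Qed.

Let density_measure_fin : fin_num_fun (density_measure g).
Proof.
move=> A mA; apply: (integrable_fin_num mA).
exact: (integrableS measurableT).
Qed.

Lemma density_measure_finite :
  exists m : {finite_measure set (measurableTypeR R) -> \bar R},
    forall A, m A = density_measure g A.
Proof.
pose m0 : {measure set (measurableTypeR R) -> \bar R} :=
  HB.pack (density_measure g) (isMeasure.Build _ _ _ _
    density_measure0 density_measure_ge0 density_measure_sigma_additive).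
pose m1 : {finite_measure set (measurableTypeR R) -> \bar R} :=
  HB.pack (m0 : set (measurableTypeR R) -> \bar R) m0
   (Measure_isFinite.Build _ _ _ m0 density_measure_fin).
by exists m1.
Qed.

Lemma density_dominated (m : {finite_measure set (measurableTypeR R) -> \bar R}) :
  (forall A, measurable A -> m A = density_measure g A) -> m `<< lam.
Proof.
move=> mE N N0 A mA AN; rewrite mE// /density_measure.
by apply: null_set_integral => //; [exact: mg|exact: N0].
Qed.

(** Change of variables holds with the Radon-Nikodym derivative of [m], which equals [g] almost
    everywhere because both integrate to [m E] over every measurable [E]. *)
Lemma integral_density (m : {finite_measure set (measurableTypeR R) -> \bar R}) h :
  (forall A, measurable A -> m A = density_measure g A) ->
  measurable_fun setT h -> (forall x, 0 <= h x) ->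
  (\int[m]_x (h x)%:E = \int[lam]_x (h x * g x)%:E)%E.
Proof.
move=> mE mh h0; have mlam := density_dominated mE.
have mhE : measurable_fun setT (EFin \o h) by exact/measurable_EFinP.
rewrite -(@Radon_Nikodym_SigmaFinite.change_of_variables _ _ _ m lam mlam (EFin \o h))//.
apply: ae_eq_integral => //.
- apply: emeasurable_funM => //.
  by apply: (measurable_int lam); exact: Radon_Nikodym_SigmaFinite.f_integrable.
- apply/measurable_EFinP; apply: measurable_funM => //.
  by apply/measurable_EFinP; exact: mg.
- rewrite (_ : (fun x => (_ * g _)%:E) = (EFin \o h) \* (EFin \o g))%E//.
  apply: ae_eqe_mul2l; apply: integral_ae_eq => //.
  - exact: Radon_Nikodym_SigmaFinite.f_integrable.
  - exact: mg.
  - move=> E _ mE'; rewrite -Radon_Nikodym_SigmaFinite.f_integral//.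
    exact: mE.
Qed.

End density_measure.

Lemma weakDP u : H1 u -> L2 (weakD u) /\ weak_derivative u (weakD u).
Proof.
move=> [_ [v Lv uv]].
have : [set v : R -> R | L2 v /\ weak_derivative u v] (weakD u).
  by apply: getI; split; [exact: Lv|exact: uv].
by [].
Qed.

(** The inequality [u_x^2 dx <= mu] in integrated form: drop the singular part, then the square of
    [rhobar]. Dropping that square avoids proving that the witness [rhobar] is zero when [rho]
    is. *)
Lemma eulerian_integral_ge u rho
    (mu : {finite_measure set (measurableTypeR R) -> \bar R}) h :
  eulerian u rho mu -> measurable_fun setT h -> (forall x, 0 <= h x) ->
  (\int[lam]_x (h x * weakD u x ^+ 2)%:E <= \int[mu]_x (h x)%:E)%E.
Proof.
move=> [Hu _ [rb [k [[_ Lrb _] [a [s [muE _ _ aE]]]]]]] mh h0.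
have [/L2P[mv iv] _] := weakDP Hu.
move/L2P : Lrb => [mrb irb].
pose g x := weakD u x ^+ 2 + rb x ^+ 2.
have g0 x : 0 <= g x by rewrite addr_ge0// sqr_ge0.
have gi : lam.-integrable setT (EFin \o g).
  exact: (@integrableD _ _ _ lam setT measurableT _ _ iv irb).
have [m mE] := density_measure_finite g0 gi.
have mhE : measurable_fun setT (EFin \o h) by exact/measurable_EFinP.
have hE0 x : (0 <= (h x)%:E)%E by rewrite lee_fin.
rewrite [leRHS](@eq_measure_integral _ _ _ setT (measure_add a s)); last first.
  by move=> A mA _; rewrite [RHS]measure_addE; exact: muE.
rewrite ge0_integral_measure_add//.
rewrite [X in (_ <= X + _)%E](@eq_measure_integral _ _ _ setT m a); last first.
  by move=> A mA _; rewrite -aE; [rewrite -mE|exact: mA].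
rewrite (@integral_density g gi m h)//.
apply: (@le_trans _ _ (\int[lam]_x (h x * g x)%:E)%E); last first.
  by rewrite leeDl// integral_ge0.
apply: ge0_le_integral => //.
- by move=> x _; rewrite lee_fin mulr_ge0// sqr_ge0.
- by apply/measurable_EFinP; apply: measurable_funM => //; exact: measurable_funX.
- apply/measurable_EFinP; apply: measurable_funM => //.
  by apply/measurable_EFinP; case/integrableP : gi.
- by move=> x _; rewrite lee_fin ler_wpM2l// lerDl sqr_ge0.
Qed.

End density.

(** * The radicand *)

Section radicand.
Context {R : realType}.
Notation lam := (@lebesgue_measure R).
Implicit Types (psi f g h u v : R -> R) (c : R).

Lemma loc_integrable_cst_finite (mu : {finite_measure set (measurableTypeR R) -> \bar R}) c :
  loc_integrable mu (cst c).
Proof.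
split=> [|K]; first exact: measurable_cst.
apply: measurable_bounded_integrable => //.
  by rewrite ltey_eq fin_num_measure.
by exists `|c|; split; [exact: num_real|move=> z Cz x _ /=; exact: ltW].
Qed.

Lemma test_integrable psi : test_function psi -> lam.-integrable setT (EFin \o psi).
Proof.
move=> tp; have := @convol_integrable R lam _ (cst 1) 0 (test_reflect 0 tp)
  (loc_integrable_cst 1).
by apply: eq_integrable => // y _; rewrite /= mulr1 !sub0r opprK.
Qed.

Lemma integral_derive1_ray psi (t : R) : test_function psi ->
  (\int[lam]_y (psi^`()%classic y * \1_(`]-oo, t]) y)%:E = (psi t)%:E)%E.
Proof.
move=> tp; have [sp [K K0]] := (test_functionP _).1 tp.
have [_ [K' K'0]] := (test_functionP _).1 (test_derive1 tp).
(* [- M] lies to the left of [t] and of both supports, so the ray may be replaced by [[- M, t]] and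
   [psi (- M)] is 0. *)
pose M : R := `|t| + `|K| + `|K'| + 1.
have Mt : - M < t.
  by rewrite ltrNl (le_lt_trans (ler_norm _))// normrN /M -!addrA ltrDl !addrA ltr_wpDl ?addr_ge0.
have M0 : 0 <= M by rewrite !addr_ge0.
pose A : set R := `[- M, t].
transitivity (\int[lam]_(y in A) (psi^`()%classic y)%:E)%E.
  rewrite [RHS]integral_mkcond; apply: eq_integral => y _.
  rewrite patchE indicE; case: ifPn => yM.
    rewrite mem_set ?mulr1//.
    by move: yM => /set_mem; rewrite /A/= !in_itv/= => /andP[].
  have [yt|ty] := leP y t; last first.
    rewrite memNset ?mulr0//= in_itv/=.
    by apply/negP; rewrite -ltNge.
  rewrite K'0 ?mul0r//.
  move: yM; rewrite notin_setE /A/= in_itv/= yt andbT => /negP; rewrite -ltNge => yM.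
  rewrite (le_lt_trans (ler_norm _))// (@ltr0_norm _ y); last first.
    by rewrite (lt_le_trans yM)// oppr_le0.
  rewrite ltrNr; apply: lt_le_trans yM _.
  by rewrite lerN2 /M; have := normr_ge0 t; have := normr_ge0 K; lra.
rewrite /A (@continuous_FTC2 _ _ psi)//.
- rewrite [psi (- M)]K0 ?sube0// normrN ger0_norm//.
  by rewrite /M; have := normr_ge0 t; have := ler_norm K; have := normr_ge0 K'; lra.
- exact/continuous_subspaceT/smooth_continuous/smooth_derive1.
- split=> [x _| |]; first exact: smooth_derivable.
    by apply: cvg_at_right_filter; exact: smooth_continuous.
  by apply: cvg_at_left_filter; exact: smooth_continuous.
Qed.

Variable phi : R -> R.
Hypothesis hphi : friedrichs_mollifier phi.
Let phi_test : test_function phi. Proof. by case: hphi. Qed.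

(** The substitution [z = x - y / c], which turns the squared integral of the radicand into a
    convolution. *)
Lemma convol_rescale c v x : 0 < c -> measurable_fun setT v ->
  lam.-integrable setT (fun z => (moll phi c (x - z) * v z)%:E) ->
  \int[lam]_y (phi y * v (x - y / c)) = convol lam (moll phi c) v x.
Proof.
move=> c0 mv iv; pose G z := moll phi c (x - z) * v z.
have cn : - c^-1 != 0 by rewrite oppr_eq0 invr_eq0 gt_eqF.
have mG : measurable_fun setT G.
  by apply/measurable_EFinP; case/integrableP : iv.
rewrite /convol -/G (Rintegral_affine x cn mG).
rewrite -RintegralZl//; last exact: integrable_affine.
apply: eq_Rintegral => y _.
rewrite normrN gtr0_norm ?invr_gt0// /G /moll.
rewrite (_ : x - (- c^-1 * y + x) = y / c); last by ring.
rewrite (_ : - c^-1 * y + x = x - y / c); last by ring.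
by rewrite (_ : c * (y / c) = y); [rewrite !mulrA mulVf ?mul1r// gt_eqF|field; rewrite gt_eqF].
Qed.

(* Fubini: [F(x - y/c)] is the [mu]-integral of [1_{z <= x - y/c}], and
   integrating [c phi'] over [y <= c (x - z)] gives [c phi (c (x - z))]. *)
Lemma convol_distr (mu : {finite_measure set (measurableTypeR R) -> \bar R}) c x :
  0 < c ->
  \int[lam]_y (c * phi^`()%classic y * distr mu (x - y / c)) =
  convol mu (moll phi c) (cst 1) x.
Proof.
move=> c0; have tp' := test_derive1 phi_test.
have mp' : measurable_fun setT phi^`() by apply: smooth_measurable; case: tp'.
pose f (z : measurableTypeR R * measurableTypeR R) : \bar R :=
  (c * phi^`()%classic z.1 * \1_(`]-oo, x]) (z.2 + z.1 / c))%:E.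
have mf : measurable_fun setT f.
  apply/measurable_EFinP; apply: measurable_funM.
    by apply: measurable_funM => //; exact: (measurableT_comp mp').
  apply: (measurableT_comp (measurable_indic _)) => //.
  by apply: measurable_funD => //; apply: measurable_funM.
(* The derivative of [phi] changes sign, so Fubini needs absolute integrability: the indicator is at
   most 1, the derivative is integrable, and [mu] is finite. *)
have ip' := test_integrable tp'.
have fi : (lam \x mu)%E.-integrable setT f.
  apply/(integrable12ltyP _ _ mf).
  apply: (@le_lt_trans _ _ (\int[lam]_y (`|c * phi^`()%classic y|%:E * mu setT))%E).
    apply: ge0_le_integral => //.
    - by move=> y _; apply: integral_ge0.
    - apply: (measurable_fun_fubini_tonelli_F (abse \o f)) => //=.
      exact: measurableT_comp.
    - apply: emeasurable_funM => //; apply/measurable_EFinP.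
      by apply: measurableT_comp => //; exact: measurable_funM.
    - move=> y _; rewrite -[leRHS]integral_cst//; apply: ge0_le_integral => //.
      + by apply: measurableT_comp => //; exact: (measurableT_comp mf).
      + move=> z _; rewrite /f lee_fin/= normrM ler_piMr// indicE.
        by case: (_ \in _); rewrite ?normr1 ?normr0.
  rewrite ge0_integralZr//.
  - rewrite lte_mul_pinfty//.
    + exact: integral_ge0.
    + have ic := @integrableZl _ _ _ lam setT measurableT c _ ip'.
      rewrite ge0_fin_numE ?integral_ge0//.
      by move: ic => /integrableP[_].
    + by rewrite ltey_eq fin_num_measure.
  - by apply/measurable_EFinP; apply: measurableT_comp => //; exact: measurable_funM.
have := Fubini fi; rewrite /f/= => fub.
rewrite /convol /Rintegral; congr fine.
transitivity (\int[lam]_y \int[mu]_z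
    (c * phi^`()%classic y * \1_(`]-oo, x]) (z + y / c))%:E)%E.
  apply: eq_integral => y _.
  have -> : (\int[mu]_z (c * phi^`()%classic y * \1_(`]-oo, x]) (z + y / c))%:E =
      \int[mu]_z ((c * phi^`()%classic y)%:E * (\1_(`]-oo, x - y / c]) z)%:E))%E.
    apply: eq_integral => z _; rewrite -EFinM; congr (_ * _)%:E.
    by rewrite !indicE; congr (_ : bool)%:R; apply/idP/idP => /set_mem/=; rewrite in_itv/= => h;
       apply/mem_set; rewrite /= in_itv/=; lra.
  rewrite integralZl//.
    rewrite integral_indic// setIT EFinM fineK//.
    exact: fin_num_measure.
  exact: integrable_indic.
rewrite fub; apply: eq_integral => z _.
rewrite mulr1 /moll EFinM -(integral_derive1_ray _ phi_test) -integralZl//; last first.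
  apply: (@le_integrable _ _ _ lam setT measurableT _ (EFin \o phi^`())) => //.
    apply/measurable_EFinP; apply: measurable_funM => //.
  move=> y _; rewrite lee_fin normrM ler_piMr// indicE.
  by case: (_ \in _); rewrite ?normr1 ?normr0.
apply: eq_integral => y _; rewrite -EFinM mulrA; congr (_ * _)%:E.
rewrite !indicE; congr (_ : bool)%:R; apply/idP/idP => /set_mem/=; rewrite in_itv/= => h;
  apply/mem_set; rewrite /= in_itv/=.
  by rewrite mulrC -ler_pdivrMr//; lra.
by move: h; rewrite mulrC -ler_pdivrMr//; lra.
Qed.

End radicand.

(** * The approximants for a fixed index *)

Section approximation.
Context {R : realType}.
Notation lam := (@lebesgue_measure R).
Variable phi : R -> R.
Hypothesis hphi : friedrichs_mollifier phi.
Variables (u : R -> R) (mu : {finite_measure set (measurableTypeR R) -> \bar R}).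
Hypothesis hD : eulerian u (fun=> 0) mu.

Let v := weakD u.
Let Hu : H1 u. Proof. by case: hD. Qed.
Let Lu : L2 u. Proof. by case: Hu. Qed.
Let Lv : L2 v. Proof. by case: (weakDP Hu). Qed.
Let uv : weak_derivative u v. Proof. by case: (weakDP Hu). Qed.
Let lu := L2_loc_integrable Lu.
Let lv := L2_loc_integrable Lv.
Let l1 := loc_integrable_cst_finite mu 1.

Section fixed_n.
Variable n : nat.
Hypothesis n0 : (0 < n)%N.

Let c : R := n%:R.
Let c0 : 0 < c. Proof. by rewrite ltr0n. Qed.
Let tm := moll_test hphi c0.
Let m0 y : 0 <= moll phi c y. Proof. exact: moll_ge0. Qed.
Let mm : measurable_fun setT (moll phi c). Proof. exact: moll_measurable. Qed.
Let M := convol mu (moll phi c) (cst 1).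
Let w := convol lam (moll phi c) v.
Let rb := approx_rhobar phi u mu n.

Let sM : smooth M. Proof. exact: convol_smooth. Qed.
Let sw : smooth w. Proof. exact: convol_smooth. Qed.

Lemma approx_u_smooth : smooth (approx_u phi u n).
Proof. exact: (convol_smooth tm lu). Qed.

Lemma approx_u_derive1 : (approx_u phi u n)^`() = w.
Proof.
rewrite (_ : approx_u phi u n = convol lam (moll phi c) u)//.
rewrite convol_derive1//; apply/funext => x.
exact: weak_derivative_convol.
Qed.

Lemma approx_radicandE x :
  approx_radicand phi u mu n x = 1 / c ^+ 2 + M x - w x ^+ 2.
Proof.
rewrite /approx_radicand -/c convol_distr// convol_rescale//.
  by case: lv.
exact: convol_integrable.
Qed.

Lemma sqr_convol_weakD_le x : w x ^+ 2 <= M x.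
Proof.
apply: (le_trans (@convol_jensen _ _ hphi c v x c0 Lv)).
rewrite -lee_fin !convol_EFin//; last exact: L2_loc_integrable_sqr.
under [leRHS]eq_integral do rewrite mulr1.
apply: (eulerian_integral_ge hD) => //; exact: measurable_reflect.
Qed.

Lemma approx_radicand_ge x : (1 / c) ^+ 2 <= approx_radicand phi u mu n x.
Proof.
rewrite approx_radicandE expr_div_n expr1n -addrA lerDl subr_ge0.
exact: sqr_convol_weakD_le.
Qed.

Let ic0 : 0 < 1 / c. Proof. by rewrite divr_gt0. Qed.

Lemma approx_radicand_gt0 x : 0 < approx_radicand phi u mu n x.
Proof. by apply: lt_le_trans (approx_radicand_ge x); rewrite exprn_gt0. Qed.

Let exprE : smooth_expr (approx_radicand phi u mu n).
Proof.
rewrite (_ : approx_radicand phi u mu n =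
  fun x => (cst (1 / c ^+ 2) x + M x) + cst (-1) x * (w x * w x)); last first.
  by apply/funext => x; rewrite approx_radicandE mulN1r expr2.
have eM := smooth_base sM; have ew := smooth_base sw.
apply: smooth_add; first by apply: smooth_add => //; exact: smooth_cst.
by apply: smooth_mul; [exact: smooth_cst|exact: smooth_mul].
Qed.

Let exprrho : smooth_expr (approx_rho phi u mu n).
Proof. by apply: smooth_sqrt => //; exact: approx_radicand_gt0. Qed.

Let exprrb : smooth_expr rb.
Proof.
rewrite (_ : rb = fun x => approx_rho phi u mu n x + cst (- (1 / c)) x)//.
by apply: smooth_add => //; exact: smooth_cst.
Qed.

Lemma approx_rho_smooth : smooth (approx_rho phi u mu n).
Proof. exact: smooth_exprW. Qed.

Lemma approx_density_smooth : smooth (approx_density phi u mu n).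
Proof.
apply: smooth_exprW.
rewrite (_ : approx_density phi u mu n = fun x => w x * w x + rb x * rb x).
  by apply: smooth_add; apply: smooth_mul => //; exact: smooth_base.
by apply/funext => x; rewrite /approx_density approx_u_derive1 !expr2.
Qed.

Lemma approx_rhobar_ge0 x : 0 <= rb x.
Proof.
rewrite subr_ge0 -[leLHS](ger0_norm (ltW ic0)) -sqrtr_sqr ler_sqrt.
  exact: approx_radicand_ge.
exact/ltW/approx_radicand_gt0.
Qed.

(** Insert [rho_n = 1 / c + rb] into [rho_n^2 = 1 / c^2 + M - w^2]: only the cross term separates
    the density from [M]. *)
Lemma approx_densityE x :
  approx_density phi u mu n x = M x - 2 / c * rb x.
Proof.
rewrite /approx_density approx_u_derive1 -/rb.
have rE : approx_rho phi u mu n x ^+ 2 = 1 / c ^+ 2 + M x - w x ^+ 2.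
  rewrite /approx_rho sqr_sqrtr; first exact: approx_radicandE.
  by apply: ltW; exact: approx_radicand_gt0.
have -> : M x = approx_rho phi u mu n x ^+ 2 - 1 / c ^+ 2 + w x ^+ 2.
  by rewrite rE; ring.
rewrite /rb /approx_rhobar -/c; field.
by rewrite gt_eqF.
Qed.

Lemma approx_density_ge0 x : 0 <= approx_density phi u mu n x.
Proof. by rewrite addr_ge0 ?sqr_ge0. Qed.

Lemma approx_density_le x : approx_density phi u mu n x <= M x.
Proof.
by rewrite approx_densityE gerBl mulr_ge0 ?divr_ge0 ?approx_rhobar_ge0 ?ltW.
Qed.

Lemma sqr_approx_rhobar_le x : rb x ^+ 2 <= M x.
Proof.
apply: le_trans (approx_density_le x).
by rewrite /approx_density -/rb lerDr sqr_ge0.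
Qed.

Lemma integral_convol_measure (D : set R) : measurable D ->
  (\int[lam]_(x in D) (M x)%:E =
   \int[mu]_y (\int[lam]_(x in D) (moll phi c (x - y))%:E))%E.
Proof.
move=> mD; rewrite -[RHS](_ : \int[mu]_y ((\int[lam]_(x in D)
    (moll phi c (x - y))%:E) * (cst 1 y)%:E) = _)%E; last first.
  by apply: eq_integral => y _; rewrite mule1.
rewrite -(@tonelli_convol _ mu (moll phi c) (cst 1) D)//.
by apply: eq_integral => x _; rewrite convol_EFin.
Qed.

Lemma convol_measure_integrable : lam.-integrable setT (EFin \o M).
Proof.
apply/integrableP; split; first by apply/measurable_EFinP; exact: smooth_measurable.
under eq_integral do rewrite /= ger0_norm ?convol_ge0//.
rewrite integral_convol_measure//.
under eq_integral do rewrite moll_integralr//.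
by rewrite integral_cst//= mul1e ltey_eq fin_num_measure.
Qed.

Lemma integral_convol_measureT : (\int[lam]_x (M x)%:E = mu setT)%E.
Proof.
rewrite integral_convol_measure//.
under eq_integral do rewrite moll_integralr//.
by rewrite integral_cst//= mul1e.
Qed.

Lemma approx_density_integrable :
  lam.-integrable setT (EFin \o approx_density phi u mu n).
Proof.
apply: le_integrable convol_measure_integrable => //.
  by apply/measurable_EFinP; apply: smooth_measurable; exact: approx_density_smooth.
move=> x _; rewrite lee_fin ger0_norm ?approx_density_ge0//.
by rewrite (le_trans (approx_density_le x))// ler_norm.
Qed.

Lemma approx_rhobar_L2 : L2 rb.
Proof.
have srb : smooth rb by exact: smooth_exprW.
apply/L2P; split; first exact: smooth_measurable.
apply: le_integrable convol_measure_integrable => //.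
  by apply/measurable_EFinP; apply: measurable_funX; exact: smooth_measurable.
move=> x _; rewrite lee_fin ger0_norm ?sqr_ge0//.
by rewrite (le_trans (sqr_approx_rhobar_le x))// ler_norm.
Qed.

Lemma approx_u_weak_derivative : weak_derivative (approx_u phi u n) w.
Proof.
by rewrite -approx_u_derive1; apply: smooth_weak_derivative; exact: approx_u_smooth.
Qed.

Lemma approx_u_L2 : L2 (approx_u phi u n). Proof. exact: (L2_convol hphi c0 Lu). Qed.

Lemma convol_weakD_L2 : L2 w. Proof. exact: L2_convol. Qed.

Lemma approx_u_H1 : H1 (approx_u phi u n).
Proof.
split; first exact: approx_u_L2.
by exists w; [exact: convol_weakD_L2|exact: approx_u_weak_derivative].
Qed.

Lemma continuous_loc_integrable (f : R -> R) : continuous f -> loc_integrable lam f.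
Proof.
move=> cf; split=> [|K]; first exact: continuous_measurable_fun.
apply: continuous_compact_integrable; first exact: segment_compact.
exact: continuous_subspaceT.
Qed.

Lemma approx_eulerian :
  eulerian (approx_u phi u n) (approx_rho phi u mu n) (approx_mu phi u mu n).
Proof.
have [m mE] := density_measure_finite approx_density_ge0 approx_density_integrable.
split; [exact: approx_u_H1|by exists m => A _; rewrite mE|].
exists rb, (1 / c); split.
  split; last by move=> x; rewrite /rb /approx_rhobar subrK.
    apply/loc_integrable_locally/continuous_loc_integrable.
    exact/smooth_continuous/approx_rho_smooth.
  exact: approx_rhobar_L2.
have [LD wD] := weakDP approx_u_H1.
(* [eulerian] speaks of the chosen [weakD] and [approx_density] of the classical derivative [w];
   they agree almost everywhere, so the two densities have the same integrals. *)
have ae := weak_derivative_unique hphi LD convol_weakD_L2 wD approx_u_weak_derivative.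
(* [mu_n] is absolutely continuous, so its singular part is the zero measure. *)
exists m, (@mzero _ (measurableTypeR R) R); split.
- by move=> A mA; rewrite /= /mzero adde0 mE.
- apply: (density_dominated approx_density_integrable) => A _; exact: mE.
- by exists set0; split; [exact: measurable0|exact: measure0|].
- move=> A mA; apply: (eq_trans _ (esym (mE A))); apply: ae_eq_integral => //.
  + apply/measurable_EFinP; apply: measurable_funD.
      by apply: measurable_funX; apply: measurable_funTS; case/L2P : LD.
    apply: measurable_funX; apply: measurable_funTS.
    by case/L2P : approx_rhobar_L2.
  + by apply/measurable_EFinP; apply: smooth_measurable; exact: approx_density_smooth.
  + have F := ae_filter_ringOfSetsType (@lebesgue_measure R).
    apply: (@filterS _ _ F) ae => x /= -> _.
    by rewrite /approx_density approx_u_derive1.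
Qed.

End fixed_n.

End approximation.

(** * Convergence *)

Section H1_convergence.
Context {R : realType}.
Notation lam := (@lebesgue_measure R).
Implicit Types f g u v : R -> R.

Lemma weak_derivativeB f f' g g' : L2 f -> L2 f' -> L2 g -> L2 g' ->
  weak_derivative f f' -> weak_derivative g g' ->
  weak_derivative (f \- g) (fun x => f' x - g' x).
Proof.
move=> Lf Lf' Lg Lg' ff' gg' psi tp.
have Lp := test_L2 tp; have Lp' := test_L2 (test_derive1 tp).
have -> : \int[lam]_x ((f \- g) x * psi^`()%classic x) =
    \int[lam]_x (f x * psi^`()%classic x) - \int[lam]_x (g x * psi^`()%classic x).
  rewrite -RintegralB//; [|exact: L2_mul_integrable..].
  by apply: eq_Rintegral => x _; rewrite /= mulrBl.
rewrite ff'// gg'// -opprD; congr (- _).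
rewrite -RintegralB//; [|exact: L2_mul_integrable..].
by apply: eq_Rintegral => x _; rewrite mulrBl.
Qed.

(** Almost everywhere uniqueness lets any weak derivative in L^2 replace the chosen one; [phi]
    enters through that uniqueness. *)
Lemma H1_normE (phi f f' : R -> R) : friedrichs_mollifier phi ->
  L2 f -> L2 f' -> weak_derivative f f' ->
  H1_norm f = (Num.sqrt (\int[lam]_x (f x ^+ 2) + \int[lam]_x (f' x ^+ 2)))%:E.
Proof.
move=> hphi Lf Lf' ff'.
have Hf : H1 f by split=> //; exists f'.
have [LD fD] := weakDP Hf.
have ae := weak_derivative_unique hphi LD Lf' fD ff'.
have [mf i2f] := (L2P _).1 Lf; have [mf' i2f'] := (L2P _).1 Lf'.
have [mD _] := (L2P _).1 LD.
have I0 (h : R -> R) : 0 <= \int[lam]_x (h x ^+ 2).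
  by apply: Rintegral_ge0 => x _; exact: sqr_ge0.
rewrite /H1_norm.
rewrite (_ : \int[lam]_x _ =
    (\int[lam]_x (f x ^+ 2) + \int[lam]_x (f' x ^+ 2))%:E)%E.
  by rewrite poweR_EFin powR12_sqrt// addr_ge0.
rewrite -RintegralD// fineK; last first.
  apply: (integrable_fin_num measurableT).
  exact: (@integrableD _ _ _ lam setT measurableT _ _ i2f i2f').
apply: ae_eq_integral => //.
- by apply/measurable_EFinP; apply: measurable_funD; apply: measurable_funX.
- by apply/measurable_EFinP; apply: measurable_funD; apply: measurable_funX.
- have F := ae_filter_ringOfSetsType (@lebesgue_measure R).
  by apply: (@filterS _ _ F) ae => x /= ->.
Qed.

(** Mollification commutes with the weak derivative, so [u_n - u] and its derivative are both
    mollification errors of L^2 functions. *)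
Lemma approx_u_cvg_H1 phi u : friedrichs_mollifier phi -> H1 u ->
  H1_norm (approx_u phi u n \- u) @[n --> \oo] --> (0 : \bar R)%E.
Proof.
move=> hphi Hu; have [Lv uv] := weakDP Hu; have [Lu _] := Hu.
set v := weakD u in Lv uv.
(* Index 0 is skipped, since [moll phi 0] is the zero function. *)
rewrite -cvg_shiftS.
pose e n := \int[lam]_x ((convol lam (moll phi n.+1%:R) u x - u x) ^+ 2).
pose e' n := \int[lam]_x ((convol lam (moll phi n.+1%:R) v x - v x) ^+ 2).
rewrite (_ : (fun n => _) = EFin \o (fun n => Num.sqrt (e n + e' n))); last first.
  apply/funext => n; have c0 : (0 : R) < n.+1%:R by rewrite ltr0n.
  have Lun := L2_convol hphi c0 Lu; have Lvn := L2_convol hphi c0 Lv.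
  apply: (H1_normE hphi); [exact: L2B|exact: L2B|].
  apply: weak_derivativeB => //.
  have tm := moll_test hphi c0.
  have -> : convol lam (moll phi n.+1%:R) v = (convol lam (moll phi n.+1%:R) u)^`().
    rewrite convol_derive1//; last exact: L2_loc_integrable.
    by apply/funext => x; rewrite (weak_derivative_convol x Lu Lv uv tm).
  exact: (smooth_weak_derivative (convol_smooth tm (L2_loc_integrable Lu))).
apply: cvg_EFin; first exact: nearW.
rewrite -[X in _ --> X]sqrtr0.
apply: (@continuous_cvg _ _ _ _ _ (fun n => e n + e' n)); first exact: sqrt_continuous.
rewrite -[X in _ --> X](addr0 0).
by apply: cvgD; exact: convol_L2_cvg.
Qed.

End H1_convergence.

(** * Convergence of the distribution functions *)

Section distribution.
Context {R : realType}.
Notation lam := (@lebesgue_measure R).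
Variable mu : {finite_measure set (measurableTypeR R) -> \bar R}.

Lemma distrE (x : R) : (distr mu x)%:E = mu `]-oo, x].
Proof. by rewrite fineK// fin_num_measure. Qed.

Let integral_indicT (A : set (measurableTypeR R)) : measurable A ->
  (\int[mu]_y (\1_A y)%:E = mu A)%E.
Proof. by move=> mA; rewrite integral_indic// setIT. Qed.

Lemma distr_cvgNy : distr mu (- k%:R) @[k --> \oo] --> 0.
Proof.
pose F k : set (measurableTypeR R) := `]-oo, (- k%:R : R)].
have F0 : \bigcap_k F k = set0.
  apply/seteqP; split=> // x /(_ (Num.bound `|x|) I); rewrite /F/= in_itv/= => xb.
  have := archi_boundP (normr_ge0 x); rewrite ltNge => /negP; apply.
  by rewrite lerNr in xb; rewrite (le_trans xb)// -normrN ler_norm.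
have : mu (F k) @[k --> \oo] --> mu (\bigcap_k F k).
  apply: nonincreasing_cvg_mu => //.
  - by rewrite ltey_eq fin_num_measure//; exact: measurable_itv.
  - by move=> k; exact: measurable_itv.
  - by rewrite F0.
  - move=> k l kl; apply/subsetPset => x; rewrite /F/= !in_itv/= => xl.
    by rewrite (le_trans xl)// lerN2 ler_nat.
by rewrite F0 measure0 => /fine_cvg.
Qed.

Variables (phi u : R -> R).
Hypothesis hphi : friedrichs_mollifier phi.
Hypothesis hD : eulerian u (fun=> 0) mu.

Section fixed_n.
Variable n : nat.
Hypothesis n0 : (0 < n)%N.
Let c : R := n%:R.
Let c0 : 0 < c. Proof. by rewrite ltr0n. Qed.
Let mdens (D : set R) : measurable_fun D (EFin \o approx_density phi u mu n).
Proof.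
by apply/measurable_EFinP; apply: smooth_measurable; exact: (approx_density_smooth hphi hD).
Qed.
Let M := convol mu (moll phi c) (cst 1).
Let mM (D : set R) : measurable_fun D (EFin \o M).
Proof.
apply/measurable_EFinP; apply: convol_measurable; first exact: moll_test.
exact: loc_integrable_cst_finite.
Qed.
Let dens0 := approx_density_ge0 phi u mu n.
Let M0 x : 0 <= M x. Proof. by apply: convol_ge0 => // y; exact: moll_ge0. Qed.
Let mmy (y : R) (D : set R) : measurable_fun D (fun x : R => (moll phi c (x - y))%:E).
Proof.
apply/measurable_EFinP; apply: measurable_funTS.
by apply: (measurableT_comp (moll_measurable hphi c0)); apply: measurable_funB.
Qed.

Lemma distr_approx_muE x :
  (distr (approx_mu phi u mu n) x)%:E = approx_mu phi u mu n `]-oo, x].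
Proof.
rewrite fineK//; apply: (@integrable_fin_num _ _ _ lam); first exact: measurable_itv.
apply: (integrableS measurableT) => //.
exact: (approx_density_integrable hphi hD).
Qed.

(** Mollification spreads a point mass at [y] over distance [1 / c]: nothing lands in [D] if [D] is
    farther away than that, and by [moll_mass1] everything does if the complement is. *)
Let moll_mass0 (D : set R) y : (forall t, D t -> 1 < c * `|t - y|) ->
  (\int[lam]_(t in D) (moll phi c (t - y))%:E = 0)%E.
Proof.
by move=> H; apply: integral0_eq => t Dt; rewrite (moll_supp hphi c0)//; exact: H.
Qed.

Let moll_mass1 (D : set R) y : measurable D ->
  (forall t, ~ D t -> 1 < c * `|t - y|) ->
  (\int[lam]_(t in D) (moll phi c (t - y))%:E = 1)%E.
Proof.
move=> mD H; rewrite -(moll_integralr hphi y c0) integral_mkcond.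
apply: eq_integral => t _; rewrite patchE; case: ifPn => //.
by rewrite notin_setE => /H Ht; rewrite (moll_supp hphi c0).
Qed.

Let moll_mass_ge0 (D : set R) y : (0 <= \int[lam]_(t in D) (moll phi c (t - y))%:E)%E.
Proof. by apply: integral_ge0 => t _; rewrite lee_fin; exact: moll_ge0. Qed.

Let moll_mass_le1 (D : set R) y : measurable D ->
  (\int[lam]_(t in D) (moll phi c (t - y))%:E <= 1)%E.
Proof.
move=> mD; rewrite -(moll_integralr hphi y c0); apply: ge0_subset_integral => //.
  exact: mmy.
by move=> t _; rewrite lee_fin; exact: moll_ge0.
Qed.

Let moll_mass_measurable (D : set R) : measurable D ->
  measurable_fun setT (fun y : R => \int[lam]_(t in D) (moll phi c (t - y))%:E)%E.
Proof.
move=> mD; apply: measurable_integral_translate => //.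
  exact: moll_measurable.
by move=> y; exact: moll_ge0.
Qed.

(** The density is at most [M], and only points [y <= x + 1 / c] can send mass into []-oo, x]]. *)
Lemma distr_approx_mu_le x :
  distr (approx_mu phi u mu n) x <= distr mu (x + 1 / c).
Proof.
rewrite -lee_fin distr_approx_muE distrE.
apply: (@le_trans _ _ (\int[lam]_(t in `]-oo, x]) (M t)%:E)%E).
  apply: ge0_le_integral => //.
  - by move=> t _; rewrite lee_fin.
  - exact: mdens.
  - exact: mM.
  - by move=> t _; rewrite lee_fin; exact: (approx_density_le hphi hD).
rewrite (@integral_convol_measure _ _ hphi mu n n0)//.
rewrite -[leRHS]integral_indicT; last exact: measurable_itv.
apply: ge0_le_integral => //.
- exact: moll_mass_measurable.
- by apply/measurable_EFinP; exact: measurable_indic.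
- move=> y _; rewrite indicE; case: (boolP (y \in _)) => [_|yx]; first exact: moll_mass_le1.
  rewrite moll_mass0// => t /=; rewrite in_itv/= => tx.
  move: yx; rewrite notin_setE/= in_itv/= => /negP; rewrite -ltNge => xy.
  rewrite -ltr_pdivrMl// mulr1 ltr_normr; apply/orP; right.
  by rewrite div1r in xy; lra.
Qed.

(** Mass of [mu] in []a + 1, x - 1 / c]] stays in []a, x]], because [1 / c <= 1]. The last term
    bounds the loss from the cross term on []a, x]]; the length [x - a] in it is what forces the cut
    at [a]. *)
Lemma distr_approx_mu_ge a x : a <= x ->
  distr mu (x - 1 / c) - distr mu (a + 1) <=
  distr (approx_mu phi u mu n) x + c^-1 * ((x - a) + fine (mu setT)).
Proof.
move=> ax; set D : set R := `]a, x].
have mD : measurable D by exact: measurable_itv.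
have c1 : c^-1 <= 1 by rewrite invf_le1// ler1n.
have ci : 0 < c^-1 by rewrite invr_gt0.
have : (mu (`](a + 1)%R, (x - 1 / c)%R]) <= \int[lam]_(t in D) (M t)%:E)%E.
  rewrite (@integral_convol_measure _ _ hphi mu n n0)//.
  rewrite -[leLHS]integral_indicT; last exact: measurable_itv.
  apply: ge0_le_integral => //.
  - by apply/measurable_EFinP; exact: measurable_indic.
  - exact: moll_mass_measurable.
  - move=> y _; rewrite indicE; case: (boolP (y \in _)) => [|_]; last exact: moll_mass_ge0.
    move=> /set_mem/=; rewrite in_itv/= => /andP[ay yx].
    rewrite moll_mass1// => t /=; rewrite /D/= in_itv/= => /negP.
    rewrite negb_and -!leNgt -?ltNge => /orP[ta|xt];
      rewrite -ltr_pdivrMl// mulr1 ltr_normr; apply/orP; [right|left].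
      by lra.
    by rewrite div1r in yx; lra.
(* The cross term is linear in [r]; [2 * r <= 1 + r^2 <= 1 + M] trades it for quantities with known
   integrals. *)
have Mle t : M t <= approx_density phi u mu n t + c^-1 * (1 + M t).
  have rM := sqr_approx_rhobar_le hphi hD n0 t; rewrite -/c -/M in rM.
  rewrite (approx_densityE hphi hD n0) -/c -/M.
  set r := approx_rhobar phi u mu n t in rM *.
  have : c^-1 * (2 * r) <= c^-1 * (1 + M t).
    by rewrite ler_pM2l//; have := sqr_ge0 (r - 1); nra.
  lra.
have MD : (\int[lam]_(t in D) (M t)%:E <= mu setT)%E.
  rewrite -(@integral_convol_measureT _ _ hphi mu n n0).
  apply: ge0_subset_integral => //; first exact: mM.
  by move=> t _; rewrite lee_fin.
have dD : (\int[lam]_(t in D) (approx_density phi u mu n t)%:E <=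
    (distr (approx_mu phi u mu n) x)%:E)%E.
  rewrite distr_approx_muE; apply: ge0_subset_integral => //.
  - exact: mdens.
  - by move=> t _; rewrite lee_fin.
  - by move=> t; rewrite /D/= !in_itv/= => /andP[].
have lD : lam D = (x - a)%:E.
  rewrite /D lebesgue_measure_itv/= lte_fin; move: ax; rewrite le_eqVlt.
  by case/predU1P => [->|->]; rewrite ?ltxx ?subrr ?EFinB.
have up : (\int[lam]_(t in D) (M t)%:E <= (distr (approx_mu phi u mu n) x)%:E +
    (c^-1 * ((x - a) + fine (mu setT)))%:E)%E.
  apply: (@le_trans _ _ (\int[lam]_(t in D) ((approx_density phi u mu n t)%:E +
      (c^-1)%:E * (1 + (M t)%:E)))%E).
    apply: ge0_le_integral => //.
    - by move=> t _; rewrite lee_fin.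
    - exact: mM.
    - apply: emeasurable_funD; first exact: mdens.
      by apply: emeasurable_funM => //; apply: emeasurable_funD => //; exact: mM.
    - by move=> t _; exact: Mle.
  rewrite ge0_integralD//; last 4 first.
  - by move=> t _; rewrite lee_fin.
  - exact: mdens.
  - by move=> t _; rewrite -EFinD -EFinM lee_fin mulr_ge0 ?addr_ge0// ltW.
  - by apply: emeasurable_funM => //; apply: emeasurable_funD => //; exact: mM.
  apply: leeD => //.
  rewrite ge0_integralZl//; last 3 first.
  - by apply: emeasurable_funD => //; exact: mM.
  - by move=> t _; rewrite -EFinD lee_fin addr_ge0.
  - by rewrite lee_fin ltW.
  rewrite EFinM; apply: lee_wpmul2l; first by rewrite lee_fin ltW.
  rewrite ge0_integralD//; last 2 first.
  - by move=> t _; rewrite lee_fin.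
  - exact: mM.
  rewrite integral_cst// mul1e EFinD fineK ?fin_num_measure//.
  by apply: leeD => //; rewrite -lD.
move=> /le_trans /(_ up) low.
rewrite lerBlDr -lee_fin !EFinD !distrE.
(* The two sets cover []-oo, x - 1 / c]] even when [a + 1] exceeds [x - 1 / c] and the first is
   empty. *)
apply: (@le_trans _ _ (mu `](a + 1)%R, (x - 1 / c)%R] + mu `]-oo, (a + 1)%R])%E).
  apply: le_trans (measureU2 _ _ _); [|exact: measurable_itv|exact: measurable_itv].
  apply: le_measure; rewrite ?inE; [exact: measurable_itv|apply: measurableU; exact: measurable_itv|].
  move=> t /=; rewrite !in_itv/= => tx; rewrite tx andbT.
  by case: (ltP (a + 1) t) => _; [left|right].
by apply: leeD => //; rewrite -EFinD.
Qed.

End fixed_n.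

Lemma distr_approx_mu_cvg x : {for x, continuous (distr mu)} ->
  distr (approx_mu phi u mu n) x @[n --> \oo] --> distr mu x.
Proof.
move=> Fx; rewrite -cvg_shiftS.
pose m := fine (mu setT).
have h0 : (1 / n.+1%:R : R) @[n --> \oo] --> (0 : R).
  rewrite (_ : (fun n => _) = harmonic); last by apply/funext => n; rewrite div1r.
  exact: cvg_harmonic.
have Fp : distr mu (x + 1 / n.+1%:R) @[n --> \oo] --> distr mu x.
  apply: (@continuous_cvg _ _ _ _ _ (fun n => x + 1 / n.+1%:R)) => //.
  by rewrite -[X in _ --> X]addr0; apply: cvgD => //; exact: cvg_cst.
have Fm : distr mu (x - 1 / n.+1%:R) @[n --> \oo] --> distr mu x.
  apply: (@continuous_cvg _ _ _ _ _ (fun n => x - 1 / n.+1%:R)) => //.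
  by rewrite -[X in _ --> X]subr0; apply: cvgB => //; exact: cvg_cst.
apply/cvgrPdist_lt => e e0.
have e3 : 0 < e / 3 by rewrite divr_gt0.
(* The cut is [a = - k - 1], so that [a + 1 = - k]. It is fixed before [n], hence [C] below does not
   depend on [n]. The three thirds pay for the left tail, the continuity of [F] at [x] and the cross
   term. *)
have [k Fk kx] : exists2 k : nat, distr mu (- k%:R) < e / 3 & - k%:R - 1 <= x.
  have [N _ HN] := (cvgrPdist_lt _ _).1 distr_cvgNy _ e3.
  exists (maxn N (Num.bound `|x|)).
    have := HN (maxn N (Num.bound `|x|)) (leq_maxl _ _).
    by rewrite sub0r normrN; apply: le_lt_trans; exact: ler_norm.
  have := archi_boundP (normr_ge0 x).
  have : ((Num.bound `|x|)%:R : R) <= (maxn N (Num.bound `|x|))%:R.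
    by rewrite ler_nat leq_maxr.
  by have := ler_norm (- x); rewrite normrN; lra.
pose C : R := x - (- k%:R - 1) + m.
have hC : C * (1 / n.+1%:R) @[n --> \oo] --> (0 : R).
  by rewrite -[X in _ --> X](mulr0 C); apply: cvgM => //; exact: cvg_cst.
have [N1 _ H1] := (cvgrPdist_lt _ _).1 Fp _ e3.
have [N2 _ H2] := (cvgrPdist_lt _ _).1 Fm _ e3.
have [N3 _ H3] := (cvgrPdist_lt _ _).1 hC _ e3.
exists (maxn N1 (maxn N2 N3)) => // n /=; rewrite !geq_max => /andP[n1 /andP[n2 n3]].
have := H1 n n1; have := H2 n n2; have := H3 n n3.
have le1 := @distr_approx_mu_le n.+1 isT x.
have le2 := @distr_approx_mu_ge n.+1 isT (- k%:R - 1) x kx.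
rewrite subrK -/m -/C [X in _ <= _ + X]mulrC in le2.
rewrite sub0r normrN !ltr_norml => /andP[_ h3] /andP[_ h2] /andP[h1 _].
rewrite !div1r in le1 le2 h1 h2 h3.
move: (distr mu (x + _)) (distr mu (x - _)) (C / _) (distr mu (- k%:R))
  (distr mu x) (distr _ x) le1 le2 h1 h2 h3 Fk => a b d f g h le1 le2 h1 h2 h3 Fk.
by apply/andP; split; lra.
Qed.

End distribution.

Unset Implicit Arguments.
Set Strict Implicit.
Set Printing Implicit Defensive.

Theorem theorem2p2 (R : realType) (phi : R -> R)
    (hphi : friedrichs_mollifier phi)
    (u : R -> R) (mu : {finite_measure set (measurableTypeR R) -> \bar R})
    (hD : eulerian u (fun=> 0) mu) :
  [/\ forall n : nat, (0 < n)%N ->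
        (forall x, 0 <= approx_radicand phi u mu n x) /\
        eulerian (approx_u phi u n) (approx_rho phi u mu n)
                 (approx_mu phi u mu n),
      forall n : nat, (0 < n)%N ->
        [/\ smooth (approx_u phi u n), smooth (approx_rho phi u mu n) &
            smooth (approx_density phi u mu n)],
      H1_norm (approx_u phi u n \- u) @[n --> \oo] --> (0 : \bar R)%E &
      forall x, {for x, continuous (distr mu)} ->
        distr (approx_mu phi u mu n) x @[n --> \oo] --> distr mu x].
Proof.
split=> [n n0|n n0| |x].
- split=> [x|]; first by apply: ltW; exact: (approx_radicand_gt0 hphi hD).
  exact: (approx_eulerian hphi hD).
- split.
  + exact: (approx_u_smooth hphi hD).
  + exact: (approx_rho_smooth hphi hD).
  + exact: (approx_density_smooth hphi hD).
- by apply: approx_u_cvg_H1 => //; case: hD.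
- exact: distr_approx_mu_cvg.
Qed.
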